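(* Let $Q$ be a quiver of type $A_n$ (vertices $1,\dots,n$, one arrow between $i$ and $i+1$ for each $1\le i\le n-1$, arbitrary orientation), and let $\mathbf D=k\tilde Q/\mathcal I$ be as in the context. For every non-zero vector $\mathbf d\in\mathbb N^n$ there exists an exceptional $\Delta$-filtered $\mathbf D$-module $M(\mathbf d)$ with $\Delta$-dimension vector $\mathbf d$, and it is unique up to isomorphism: any two exceptional $\Delta$-filtered $\mathbf D$-modules with $\Delta$-dimension vector $\mathbf d$ are isomorphic.
   Context: Let $k$ be an algebraically closed field of characteristic zero. For a quiver $Q=(Q_0,Q_1,s,t)$ without oriented cycles, its double $\tilde Q$ has vertex set $Q_0$ and arrow set $Q_1\cup\{\alpha^*:\alpha\in Q_1\}$ with $\alpha^*:t(\alpha)\to s(\alpha)$. Paths are composed from right to left ($\rho\gamma$ means first $\gamma$, then $\rho$). Let $\mathcal I\subseteq k\tilde Q$ be the ideal generated by (1) $\alpha^*\alpha-\sum_{\gamma\in Q_1,\ t(\gamma)=s(\alpha)}\gamma\gamma^*$ for every $\alpha\in Q_1$, and (2) $\beta^*\alpha$ for all $\alpha\neq\beta\in Q_1$ with $t(\alpha)=t(\beta)$. Put $\mathbf D=k\tilde Q/\mathcal I$; modules are finite-dimensional left modules, identified with representations of $(\tilde Q,\mathcal I)$. The path algebra $kQ$ is a subalgebra of $\mathbf D$, and sending each $\alpha^*$ to $0$ gives a surjection $\mathbf D\to kQ$; modules are transported along these maps. For $i\in Q_0$, $\Delta(i)$ denotes the indecomposable projective $kQ$-module with simple top $L(i)$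 (a basis is given by the paths of $Q$ starting at $i$), regarded as a $\mathbf D$-module. A $\mathbf D$-module $M$ is $\Delta$-filtered if it has a chain of submodules $M=M(1)\supset M(2)\supset\cdots\supset M(r)=0$ with each $M(l)/M(l+1)$ isomorphic to some $\Delta(j)$; equivalently, the restriction of $M$ to $kQ$ is a projective $kQ$-module; equivalently, every $M_\alpha$ ($\alpha\in Q_1$) is injective and $\mathrm{Im}(M_\alpha)\cap\sum_{\beta\in Q_1\setminus\{\alpha\},\,t(\beta)=t(\alpha)}\mathrm{Im}(M_\beta)=0$. The $\Delta$-dimension vector $\underline{\dim}_\Delta(M)\in\mathbb N^{Q_0}$ has $i$-th entry the multiplicity of $\Delta(i)$ in such a filtration (equivalently, in the decomposition of $M$ as a projective $kQ$-module). A $\mathbf D$-module $M$ is exceptional if $\mathrm{Ext}^1_{\mathbf D}(M,M)=0$. *)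

(* Defs.v *)
From HB Require Import structures.
From mathcomp Require Import all_boot all_order all_algebra.
Set Implicit Arguments. Unset Strict Implicit. Unset Printing Implicit Defensive.
Import GRing.Theory.
Local Open Scope ring_scope.

(* Conventions (0-based).  Quiver Q of type A_n: vertices 0..n-1, and for each
   j with j.+1 < n an arrow a_j between j and j.+1, oriented j -> j.+1 iff
   [o j] (otherwise j.+1 -> j).  The double quiver has, for every such j,
   exactly one map in each direction between j and j.+1.

   A representation of the double quiver is stored as: a dimension for every
   vertex (nat-indexed, required to vanish for vertices >= n), a matrix
   [rF j] for the map V_j -> V_(j+1) and a matrix [rB j] for the map
   V_(j+1) -> V_j.  Linear maps act on ROW vectors: x |-> x *m A, so the
   composite "first A then B" is A *m B. *)
Record rep (k : fieldType) := Rep {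
  rdim : nat -> nat;
  rF : forall j : nat, 'M[k]_(rdim j, rdim j.+1);
  rB : forall j : nat, 'M[k]_(rdim j.+1, rdim j) }.

Definition is_hom (k : fieldType) (M N : rep k)
    (f : forall v : nat, 'M[k]_(rdim M v, rdim N v)) : Prop :=
  forall j : nat, rF M j *m f j.+1 = f j *m rF N j /\
                  rB M j *m f j = f j.+1 *m rB N j.

Definition isomorphic (k : fieldType) (M N : rep k) : Prop :=
  exists (f : forall v, 'M[k]_(rdim M v, rdim N v))
         (g : forall v, 'M[k]_(rdim N v, rdim M v)),
    is_hom f /\ is_hom g /\
    forall v, f v *m g v = 1%:M /\ g v *m f v = 1%:M.

(* M is a (finite-dimensional) module over D = k~Q / I, i.e. a representation
   of the double quiver satisfying the relations (1) and (2):
   (1) for a_j : j -> j+1 :  a_j^* a_j = sum over arrows gamma into j of gamma gamma^*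
       for a_j : j+1 -> j :  a_j^* a_j = sum over arrows gamma into j+1 of gamma gamma^*
   (2) beta^* alpha = 0 for the two distinct arrows a_i : i -> i+1 and
       a_(i+1) : i+2 -> i+1 having common target i+1. *)
Definition is_Dmod (k : fieldType) (n : nat) (o : nat -> bool) (M : rep k) : Prop :=
  [/\ (forall v, (n <= v)%N -> rdim M v = 0%N),
      (o 0%N -> (1 < n)%N -> rF M 0 *m rB M 0 = 0),
      (forall i, (i.+2 < n)%N -> o i.+1 ->
          rF M i.+1 *m rB M i.+1 = if o i then rB M i *m rF M i else 0),
      (forall j, (j.+1 < n)%N -> ~~ o j ->
          rB M j *m rF M j =
            if (j.+2 < n)%N && ~~ o j.+1 then rF M j.+1 *m rB M j.+1 else 0)
    & (forall i, (i.+2 < n)%N -> o i -> ~~ o i.+1 ->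
          rF M i *m rF M i.+1 = 0 /\ rB M i.+1 *m rB M i = 0)].

(* Delta-filtered: every map M_alpha (alpha in Q_1) is injective, and
   Im M_alpha meets the sum of the images of the other arrows with the same
   target trivially (only case: a_i : i -> i+1 and a_(i+1) : i+2 -> i+1). *)
Definition Delta_filtered (k : fieldType) (n : nat) (o : nat -> bool) (M : rep k) : Prop :=
  (forall j, (j.+1 < n)%N -> if o j then row_free (rF M j) else row_free (rB M j)) /\
  (forall i, (i.+2 < n)%N -> o i -> ~~ o i.+1 ->
      \rank (rF M i :&: rB M i.+1)%MS = 0%N).

(* number of paths of Q from i to v (0 or 1 in type A); this is the dimension
   at vertex v of Delta(i) = kQ e_i *)
Definition npaths (o : nat -> bool) (i v : nat) : nat :=
  if (i <= v)%N then all o (iota i (v - i))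
  else all (fun j => ~~ o j) (iota v (i - v)).

(* Delta-dimension vector d: the dimension vector of M equals
   sum_i d_i * dim Delta(i) (multiplicities in a Delta-filtration). *)
Definition Delta_dim (k : fieldType) (n : nat) (o : nat -> bool) (M : rep k)
    (d : 'I_n -> nat) : Prop :=
  forall v : 'I_n, rdim M v = (\sum_(i < n) d i * npaths o i v)%N.

(* Exceptional: Ext^1_D(M, M) = 0, i.e. every short exact sequence of
   D-modules 0 -> M -> E -> M -> 0 splits. *)
Definition exceptional (k : fieldType) (n : nat) (o : nat -> bool) (M : rep k) : Prop :=
  forall (E : rep k) (iota : forall v, 'M[k]_(rdim M v, rdim E v))
         (p : forall v, 'M[k]_(rdim E v, rdim M v)),
    is_Dmod n o E -> is_hom iota -> is_hom p ->
    (forall v, [/\ row_free (iota v), row_full (p v) & (iota v == kermx (p v))%MS]) ->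
    exists s : forall v, 'M[k]_(rdim M v, rdim E v),
      is_hom s /\ forall v, s v *m p v = 1%:M.
Arguments Delta_dim [k] n o M d.

(* Main.v *)
Require Import Defs.
From HB Require Import structures.
From mathcomp Require Import all_boot all_order all_algebra.
From mathcomp Require Import fingroup perm ring.

(* A Delta-filtered module is a projective kQ-module P together with
   X = sum_gamma gamma gamma^*, an arbitrary homomorphism P -> rad P.  In a
   basis of generators, End(P) becomes the algebra q of N x N matrices with
   entries only at positions allowed by the paths of Q, and Hom(P, rad P) its
   ideal n of entries along non-trivial paths; isomorphism is conjugation by
   units of q, and Ext^1(M, M) = n / [q, x].  So one has to show that the
   x in n with [q, x] = n ("rigid") exist and are all conjugate.

   Uniqueness: on the line z through two rigid elements x and y, the map
   a |-> a x - z a is onto n for all but finitely many z, and its kernel then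
   contains an invertible matrix, because it does at z = x; likewise for y, so
   both are conjugate to a common z.

   Existence: the vertices are added one at a time.  The centraliser of x acts
   on the cokernel of x on the current linear segment of Q, and the induction
   maintains that this action contains a Borel subalgebra.  Choosing the new
   entries of x opposite to its flag keeps x rigid, and the enlarged
   centraliser again contains a Borel subalgebra, also after a change of
   orientation, where x is transposed. *)

Set Implicit Arguments. Unset Strict Implicit. Unset Printing Implicit Defensive.
Import GRing.Theory.
Local Open Scope ring_scope.

(** * Supports and the rigidity condition *)

Definition msupp (k : fieldType) m n (R : 'I_m -> 'I_n -> bool)
    (A : 'M[k]_(m, n)) : Prop := forall i j, ~~ R i j -> A i j = 0.

(** [R] and [S] are arbitrary relations, so that the notion survives adjoining generators and
    transposing; for the quiver they describe the algebra q and its ideal n. *)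
Definition rigid (k : fieldType) N (R S : rel 'I_N) (x : 'M[k]_N) : Prop :=
  forall y, msupp S y -> exists2 a, msupp R a & a *m x - x *m a = y.

Section Supports.
Variable k : fieldType.

Lemma msupp0 m n (R : 'I_m -> 'I_n -> bool) : msupp R (0 : 'M[k]_(m, n)).
Proof. by move=> i j _; rewrite mxE. Qed.

Lemma msuppD m n (R : 'I_m -> 'I_n -> bool) (A B : 'M[k]_(m, n)) :
  msupp R A -> msupp R B -> msupp R (A + B).
Proof. by move=> hA hB i j h; rewrite mxE hA // hB // addr0. Qed.

Lemma msuppN m n (R : 'I_m -> 'I_n -> bool) (A : 'M[k]_(m, n)) :
  msupp R A -> msupp R (- A).
Proof. by move=> hA i j h; rewrite mxE hA // oppr0. Qed.

Lemma msuppM m n p (R : 'I_m -> 'I_n -> bool) (S : 'I_n -> 'I_p -> bool)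
    (T : 'I_m -> 'I_p -> bool) (A : 'M[k]_(m, n)) (B : 'M[k]_(n, p)) :
  (forall i j l, R i j -> S j l -> T i l) ->
  msupp R A -> msupp S B -> msupp T (A *m B).
Proof.
move=> trT hA hB i l /negP nT; rewrite mxE big1 // => j _.
case: (boolP (R i j)) => [Rij|/hA->]; last by rewrite mul0r.
by rewrite hB ?mulr0 //; apply/negP => Sjl; apply: nT; apply: trT Sjl.
Qed.

Lemma msuppMl m n p (C : pred 'I_p) (A : 'M[k]_(m, n)) (B : 'M[k]_(n, p)) :
  msupp (fun _ : 'I_n => C) B -> msupp (fun _ : 'I_m => C) (A *m B).
Proof. by move=> hB; apply: (msuppM (R := fun _ _ => true)) hB. Qed.

Lemma msupp_tr m n (R : 'I_m -> 'I_n -> bool) (A : 'M[k]_(m, n)) :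
  msupp R A -> msupp (fun i j => R j i) A^T.
Proof. by move=> hA i j h; rewrite mxE hA. Qed.

Lemma msupp_col_mx m1 m2 n (C : pred 'I_n) (A : 'M[k]_(m1, n)) (B : 'M[k]_(m2, n)) :
  msupp (fun=> C) A -> msupp (fun=> C) B -> msupp (fun=> C) (col_mx A B).
Proof.
move=> sA sB i j h.
by case: (split_ordP i) => i' ->; rewrite ?col_mxEu ?col_mxEd ?sA ?sB.
Qed.

Lemma msupp_eq m n (R R' : 'I_m -> 'I_n -> bool) (A : 'M[k]_(m, n)) :
  R =2 R' -> msupp R A -> msupp R' A.
Proof. by move=> e hA i j; rewrite -e; apply: hA. Qed.

(** Transposition reverses products and so changes the sign of the commutator; hence the equation is
    solved for the negative of the transposed right-hand side. *)
Lemma rigid_tr N (R S : rel 'I_N) (x : 'M[k]_N) :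
  rigid R S x -> rigid (fun p q => R q p) (fun p q => S q p) x^T.
Proof.
move=> rx y /msupp_tr/(@msuppN _ _ _ _) /rx [a ha e].
exists a^T; first exact: msupp_tr.
by rewrite -!trmx_mul -linearB /= -opprB e opprK trmxK.
Qed.

Lemma rigid_eq N (R S R' S' : rel 'I_N) (x : 'M[k]_N) :
  R =2 R' -> S =2 S' -> rigid R S x -> rigid R' S' x.
Proof.
move=> eR eS rx y hy; have [|a ha e] := rx y; last by exists a => //; apply: msupp_eq ha.
by apply: msupp_eq hy => p q; rewrite eS.
Qed.

End Supports.

(** * Existence of a rigid element *)

(* The centraliser of [x] in the algebra of matrices supported on [R] acts on
   the quotient of the row vectors supported on [C] by their image under [x];
   [flagged] says that this action contains a Borel subalgebra.  The rows of
   [H] are the adapted basis, and [T] ranges over the lower triangular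
   matrices. *)
Definition flagged (k : fieldType) N (R : rel 'I_N) (C : pred 'I_N)
    (x : 'M[k]_N) : Prop :=
  exists h, exists2 H : 'M[k]_(h, N), msupp (fun=> C) H &
    (forall m (u : 'M[k]_(m, N)), msupp (fun=> C) u ->
       exists w c, msupp (fun=> C) w /\ u = w *m x + c *m H) /\
    (forall T : 'M[k]_h, is_trig_mx T -> exists a W,
       [/\ msupp R a, a *m x = x *m a, msupp (fun=> C) W
         & H *m a = T *m H + W *m x]).

Definition admissible (k : fieldType) N (R S : rel 'I_N) (C : pred 'I_N) : Prop :=
  exists x : 'M[k]_N, [/\ msupp S x, rigid R S x & flagged R C x].

Lemma admissible_eq (k : fieldType) N (R S R' S' : rel 'I_N) (C C' : pred 'I_N) :
  R =2 R' -> S =2 S' -> C =1 C' -> admissible k R S C -> admissible k R' S' C'.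
Proof.
move=> eR eS eC [x [sx rx [h [H sH [sp tr]]]]].
have eCC m : (fun _ : 'I_m => C) =2 (fun _ : 'I_m => C') by move=> ? ?; apply: eC.
have eCC' m : (fun _ : 'I_m => C') =2 (fun _ : 'I_m => C) by move=> ? ?; rewrite eC.
exists x; split; [exact: msupp_eq sx|exact: rigid_eq rx|].
exists h, H; first exact: msupp_eq sH.
split=> [m u /(msupp_eq (eCC' _))/sp [w [c [sw e]]]|T /tr [a [W [sa ca sW e]]]].
  by exists w, c; split=> //; apply: msupp_eq sw.
by exists a, W; split=> //; [apply: msupp_eq sa|apply: msupp_eq sW].
Qed.

(** * Adjoining the generators at one more vertex *)

Section Extension.
Variable k : fieldType.

(** The [d] new generators come last, and [C] marks the old ones joined to the new vertex by a path.
    The flag [b] allows the new diagonal block: it is true for the algebra and false for the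
    ideal. *)
Definition ext_rel N d (R : rel 'I_N) (C : pred 'I_N) (b : bool) : rel 'I_(N + d) :=
  fun p q => match split p, split q with
    | inl p', inl q' => R p' q'
    | inr _, inl q' => C q'
    | inr _, inr _ => b
    | inl _, inr _ => false
    end.

Definition ext_pred N d (C : pred 'I_N) (b : bool) : pred 'I_(N + d) :=
  fun p => match split p with inl p' => C p' | inr _ => b end.

Lemma msupp_ext N d (R : rel 'I_N) (C : pred 'I_N) b
    (A : 'M[k]_N) (B : 'M[k]_(d, N)) (D : 'M[k]_d) :
  msupp R A -> msupp (fun=> C) B -> (b || (D == 0)) ->
  msupp (ext_rel R C b) (block_mx A 0 B D).
Proof.
move=> sA sB hD p q; rewrite /ext_rel.
case: (split_ordP p) => p' ->; case: (split_ordP q) => q' ->;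
  rewrite ?block_mxEul ?block_mxEur ?block_mxEdl ?block_mxEdr.
- exact: sA.
- by rewrite mxE.
- exact: sB.
- by case: b hD => //= /eqP->; rewrite mxE.
Qed.

Lemma ext_decomp N d (S : rel 'I_N) (C : pred 'I_N) (y : 'M[k]_(N + d)) :
  msupp (ext_rel (d := d) S C false) y ->
  exists A B, [/\ y = block_mx A 0 B 0, msupp S A & msupp (fun _ : 'I_d => C) B].
Proof.
move=> sy; exists (ulsubmx y), (dlsubmx y); split.
- rewrite -[LHS]submxK; congr block_mx; apply/matrixP=> i j;
    rewrite !mxE sy // /ext_rel.
    by rewrite (unsplitK (inl _ : 'I_N + 'I_d)) (unsplitK (inr _ : 'I_N + 'I_d)).
  by rewrite !(unsplitK (inr _ : 'I_N + 'I_d)).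
- move=> i j h; rewrite !mxE sy // /ext_rel.
  by rewrite !(unsplitK (inl _ : 'I_N + 'I_d)).
- move=> i j h; rewrite !mxE sy // /ext_rel.
  by rewrite (unsplitK (inl _ : 'I_N + 'I_d)) (unsplitK (inr _ : 'I_N + 'I_d)).
Qed.

Lemma msupp_ext_row N d m (C : pred 'I_N) b (A : 'M[k]_(m, N)) (B : 'M[k]_(m, d)) :
  msupp (fun=> C) A -> b || (B == 0) -> msupp (fun=> ext_pred C b) (row_mx A B).
Proof.
move=> sA hB p q; rewrite /ext_pred.
case: (split_ordP q) => q' ->; rewrite ?row_mxEl ?row_mxEr; first exact: sA.
by case: b hB => //= /eqP->; rewrite mxE.
Qed.

Lemma ext_pred_decomp N d m (C : pred 'I_N) b (u : 'M[k]_(m, N + d)) :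
  msupp (fun=> ext_pred C b) u ->
  exists A B, [/\ u = row_mx A B, msupp (fun=> C) A & b || (B == 0)].
Proof.
move=> su; exists (lsubmx u), (rsubmx u); split; first by rewrite hsubmxK.
  by move=> i j h; rewrite !mxE su // /ext_pred (unsplitK (inl _ : 'I_N + 'I_d)).
case: b su => //= su; apply/eqP/matrixP=> i j.
by rewrite !mxE su // /ext_pred (unsplitK (inr _ : 'I_N + 'I_d)).
Qed.

Lemma bracket_ext N d (a x : 'M[k]_N) (b xi : 'M[k]_(d, N)) (c : 'M[k]_d) :
  block_mx a 0 b c *m block_mx x 0 xi 0 - block_mx x 0 xi 0 *m block_mx a 0 b c
  = block_mx (a *m x - x *m a) 0 (b *m x + c *m xi - xi *m a) 0.
Proof.
rewrite !mulmx_block !(mulmx0, mul0mx, addr0, add0r) opp_block_mx add_block_mx.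
by rewrite !oppr0 !addr0.
Qed.

Variables (N : nat) (R S : rel 'I_N) (C : pred 'I_N).
Hypotheses (trR : forall p q r, R p q -> R q r -> R p r)
  (subSR : forall p q, S p q -> R p q) (closC : forall p q, C p -> R p q -> C q).

Let suppCM m (u : 'M[k]_(m, N)) a :
  msupp (fun=> C) u -> msupp R a -> msupp (fun=> C) (u *m a).
Proof. by apply: msuppM => _ j l; apply: closC. Qed.

(** The old block of the equation is solved by rigidity of [x]. The error left in the new rows is
    [Z *m H] modulo the image of [x]; the last hypothesis, which says that the orbit of [K] under
    GL_d and the Borel subgroup is open infinitesimally, writes [Z] through [c] and [T], and the
    centraliser of [x] realises [T]. *)
Lemma rigid_ext d h (x : 'M[k]_N) (H : 'M[k]_(h, N)) (K : 'M[k]_(d, h)) :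
  msupp S x -> rigid R S x ->
  msupp (fun=> C) H ->
  (forall m (u : 'M[k]_(m, N)), msupp (fun=> C) u ->
       exists w c, msupp (fun=> C) w /\ u = w *m x + c *m H) ->
  (forall T : 'M[k]_h, is_trig_mx T -> exists a W,
       [/\ msupp R a, a *m x = x *m a, msupp (fun=> C) W
         & H *m a = T *m H + W *m x]) ->
  (forall Z : 'M[k]_(d, h), exists c T, is_trig_mx T /\ Z = c *m K - K *m T) ->
  rigid (ext_rel R C true) (ext_rel S C false) (block_mx x 0 (K *m H) 0).
Proof.
move=> sx rx sH spanH flagH hK y /ext_decomp [y1 [y2 [-> sy1 sy2]]].
have [a0 sa0 e0] := rx _ sy1.
have [w [Z [sw eZ]]] : exists w Z, msupp (fun=> C) w /\
    y2 + K *m H *m a0 = w *m x + Z *m H.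
  by apply: spanH; apply: msuppD => //; apply: suppCM => //; apply: msuppMl.
have [c [T [trT defZ]]] := hK Z.
have [a [W [sa ca sW eH]]] := flagH _ trT.
exists (block_mx (a0 + a) 0 (w + K *m W) c).
  by apply: msupp_ext => //; apply: msuppD => //; apply: msuppMl.
rewrite bracket_ext; congr block_mx.
  by rewrite mulmxDl mulmxDr ca opprD addrACA subrr addr0.
rewrite mulmxDr -(mulmxA K H a) eH mulmxDr !mulmxDl.
rewrite -(addrK (K *m H *m a0) y2) eZ defZ mulmxBl !mulmxA.
by apply/matrixP=> i j; rewrite !mxE; ring.
Qed.

(** The last conclusion prepares a change of orientation, after which only the action on the new
    generators matters. *)
Lemma admissible_ext d : admissible k R S C ->
  exists x' : 'M[k]_(N + d),
    [/\ msupp (ext_rel S C false) x', rigid (ext_rel R C true) (ext_rel S C false) x',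
        flagged (ext_rel R C true) (ext_pred C true) x'
      & forall T : 'M[k]_d, is_trig_mx T -> exists a,
          [/\ msupp (ext_rel R C true) a, a *m x' = x' *m a & drsubmx a = T]].
Proof.
case=> x [sx rx [h [H sH [spanH flagH]]]].
have sxR : msupp R x by move=> p q nR; apply: sx; apply: contra nR => /subSR.
(* The new rows are the last [d] vectors of the adapted basis if [d <= h], and otherwise all of [H]
   preceded by zero rows. The new adapted family has max(h, d) members. *)
have [led|/ltnW leh] := leqP d h.
  move: H sH spanH flagH; rewrite -(subnK led); set s := (h - d)%N => H sH spanH flagH.
  move: H sH spanH flagH => H; rewrite -(vsubmxK H).
  move: (usubmx H) (dsubmx H) => H1 H2 {H} sH spanH flagH.
  have sH1 : msupp (fun=> C) H1.
    by move=> i j /(sH (lshift d i)); rewrite col_mxEu.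
  have sH2 : msupp (fun=> C) H2.
    by move=> i j /(sH (rshift s i)); rewrite col_mxEd.
  have KH : row_mx 0 1%:M *m col_mx H1 H2 = H2 by rewrite mul_row_col mul0mx mul1mx add0r.
  have key (T : 'M[k]_(s + d)) : is_trig_mx T -> exists a W,
      [/\ msupp (ext_rel R C true) a, a *m block_mx x 0 H2 0 = block_mx x 0 H2 0 *m a,
          msupp (fun=> ext_pred C true) W, drsubmx a = drsubmx T &
          block_mx H1 0 0 1%:M *m a = T *m block_mx H1 0 0 1%:M + W *m block_mx x 0 H2 0].
    rewrite -(submxK T) is_trig_block_mx // block_mxKdr => /and3P[/eqP-> tr1 tr2].
    move: (ulsubmx T) (dlsubmx T) (drsubmx T) tr1 tr2 => T11 T21 T22 tr1 tr2 {T}.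
    have [|a1 [W [sa1 ca1 sW]]] := flagH (block_mx T11 0 0 T22).
      by rewrite is_trig_block_mx // eqxx tr1.
    rewrite -(vsubmxK W) mul_col_mx mul_block_col mul_col_mx !(mul0mx, add0r, addr0) add_col_mx.
    case/eq_col_mx => e1 e2.
    have sW1 : msupp (fun=> C) (usubmx W) by move=> i j; rewrite mxE; apply: sW.
    have sW2 : msupp (fun=> C) (dsubmx W) by move=> i j; rewrite mxE; apply: sW.
    have [w [c [sw eW2]]] := spanH _ _ sW2.
    move: c eW2 => c; rewrite -(hsubmxK c) mul_row_col => eW2.
    (* With the row [dsubmx W] alone, the new generators would acquire the component [lsubmx c]
       along [H1]; a second element [a2] of the centraliser changes it to the prescribed [T21]. *)
    have [|a2 [W' [sa2 ca2 sW']]] := flagH (block_mx 0 0 (T21 - lsubmx c) 0).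
      by rewrite is_trig_block_mx // eqxx !mx0_is_trig.
    rewrite -(vsubmxK W') mul_col_mx mul_block_col mul_col_mx !(mul0mx, add0r, addr0) add_col_mx add0r.
    case/eq_col_mx => e1' e2'.
    have sW1' : msupp (fun=> C) (usubmx W') by move=> i j; rewrite mxE; apply: sW'.
    have sW2' : msupp (fun=> C) (dsubmx W') by move=> i j; rewrite mxE; apply: sW'.
    exists (block_mx (a1 + a2 *m x) 0 (dsubmx W + H2 *m a2) T22).
    exists (block_mx (usubmx W + usubmx W' *m x) 0 (w + dsubmx W') (rsubmx c)); split.
    - apply: msupp_ext => //; first by apply: msuppD => //; apply: msuppM sa2 sxR.
      by apply: msuppD => //; apply: suppCM.
    - apply/eqP; rewrite -subr_eq0 bracket_ext.
      rewrite mulmxDl mulmxDr ca1 (mulmxA x a2) -ca2 subrr.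
      rewrite mulmxDl mulmxDr e2 (mulmxA H2 a2 x).
      rewrite [X in block_mx _ _ X _](_ : _ = 0) ?block_mx0 //.
      by apply/matrixP=> i j; rewrite !mxE; ring.
    - apply: msupp_col_mx; apply: msupp_ext_row => //; apply: msuppD => //.
      exact: suppCM.
    - by rewrite block_mxKdr.
    rewrite !mulmx_block !(mulmx0, mul0mx, mul1mx, mulmx1, addr0, add0r) add_block_mx ?addr0 ?add0r.
    rewrite mulmxDr e1 mulmxA e1' e2' {1}eW2 !mulmxDl ?mulNmx; congr block_mx;
    by apply/matrixP=> i j; rewrite !mxE; ring.
  exists (block_mx x 0 H2 0); split.
  - by apply: msupp_ext; rewrite ?eqxx ?orbT.
  - rewrite -{1}KH; apply: (rigid_ext sx rx sH spanH flagH) => Z.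
    (* Here [K] is [row_mx 0 1%:M]: the last [d] columns of [Z] are filled by [c], the others by the
       strictly lower block of [T]. This is where the choice opposite to the flag enters. *)
    exists (rsubmx Z), (block_mx 0 0 (- lsubmx Z) 0).
    split; first by rewrite is_trig_block_mx // eqxx !mx0_is_trig.
    rewrite mul_mx_row mulmx0 mulmx1 mul_row_block !mul1mx !mul0mx !add0r.
    by rewrite opp_row_mx add_row_mx add0r opprK oppr0 addr0 hsubmxK.
  - exists (s + d)%N, (block_mx H1 0 0 1%:M).
      by apply: msupp_col_mx; apply: msupp_ext_row => //; exact: msupp0.
    split=> [m u /ext_pred_decomp [u1 [u2 [-> su1 _]]]|T /key[a [W [? ? ? ? ?]]]]; last by exists a, W.
    have [w [c [sw ->]]] := spanH _ _ su1.
    exists (row_mx w (rsubmx c)), (row_mx (lsubmx c) u2).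
    split; first exact: msupp_ext_row.
    rewrite -{1}(hsubmxK c) mul_row_col !mul_row_block !(mulmx0, mulmx1, addr0, add0r) add_row_mx add0r.
    by rewrite addrA addrAC.
  move=> T trT; have [|a [W [sa ca _ eT _]]] := key (block_mx 0 0 0 T).
    by rewrite is_trig_block_mx // eqxx mx0_is_trig.
  by exists a; split=> //; rewrite eT block_mxKdr.
move: (leh); rewrite -(subnK leh); set t := (d - h)%N => _ {leh}.
pose K : 'M[k]_(t + h, h) := col_mx 0 1%:M.
have sKH : msupp (fun=> C) (K *m H) by apply: msuppMl.
have key (T : 'M[k]_(t + h)) : is_trig_mx T -> exists a W,
      [/\ msupp (ext_rel R C true) a, a *m block_mx x 0 (K *m H) 0 = block_mx x 0 (K *m H) 0 *m a,
          msupp (fun=> ext_pred C true) W, drsubmx a = T &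
          row_mx 0 1%:M *m a = T *m row_mx 0 1%:M + W *m block_mx x 0 (K *m H) 0].
  move=> trT.
  (* A lower triangular [T] preserves the zero rows of [K], so it acts on [K] through its lower
     right block. *)
  have eK : T *m K = K *m drsubmx T.
    move: trT; rewrite -{1 2}(submxK T) is_trig_block_mx // => /and3P[/eqP-> _ _].
    by rewrite mul_block_col mul_col_mx !(mulmx0, mul0mx, add0r, mul1mx, mulmx1).
  have [|a [W [sa ca sW e]]] := flagH (drsubmx T); first exact: drsubmx_trig.
  have [w [c [sw eW]]] := spanH _ _ sW.
  exists (block_mx a 0 (K *m W) T), (row_mx (K *m w) (row_mx 0 (K *m c))); split.
  - by apply: msupp_ext => //; apply: msuppMl.
  - apply/eqP; rewrite -subr_eq0 bracket_ext ca subrr.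
    rewrite mulmxA eK -(mulmxA K H a) e mulmxDr !mulmxA.
    by rewrite [_ + K *m _ *m H]addrC subrr block_mx0.
  - by apply: msupp_ext_row => //; apply: msuppMl.
  - by rewrite block_mxKdr.
  - rewrite !mul_row_block !mul_mx_row !(mulmx0, mul0mx, mul1mx, mulmx1, addr0, add0r).
    rewrite add_row_mx addr0 add0r eW mulmxDr !mulmxA mul_row_col mul0mx add0r mulmx1.
    by [].
exists (block_mx x 0 (K *m H) 0); split.
- by apply: msupp_ext; rewrite ?eqxx ?orbT.
- apply: (rigid_ext sx rx sH spanH flagH) => Z.
  (* The products [c *m K] already exhaust all [Z]. *)
  exists (row_mx 0 Z), 0; rewrite mx0_is_trig; split=> //.
  by rewrite mul_row_col !mulmx0 mulmx1 add0r subr0.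
- exists (t + h)%N, (row_mx 0 1%:M); first by apply: msupp_ext_row => //; exact: msupp0.
  split=> [m u /ext_pred_decomp [u1 [u2 [-> su1 _]]]|T /key[a [W [? ? ? ? ?]]]]; last by exists a, W.
  have [w [c [sw ->]]] := spanH _ _ su1.
  exists (row_mx w (row_mx 0 c)), u2; split; first exact: msupp_ext_row.
  rewrite mul_row_block mul_mx_row !(mulmx0, mulmx1, addr0, add0r) add_row_mx addr0 add0r.
  by rewrite mulmxA mul_row_col mul0mx add0r mulmx1.
by move=> T /key [a [W [? ? ? ? ?]]]; exists a.
Qed.

(** After a change of orientation the current segment consists of the new vertex alone. The
    transposed matrix kills the rows supported there, so the cokernel is spanned by the new
    generators, on which the transposed centraliser acts by the transposes of the [T] in
    [admissible_ext]. *)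
Lemma admissible_turn d : admissible k R S C ->
  admissible k (fun p q => ext_rel (d := d) R C true q p)
               (fun p q => ext_rel (d := d) S C false q p) (ext_pred pred0 true).
Proof.
case/(admissible_ext d) => x [sx rx _ flag].
have [A [B [ex _ _]]] := ext_decomp sx.
exists x^T; split; [exact: msupp_tr|exact: rigid_tr|].
(* These transposes are upper triangular; reversing the order of the basis makes them lower
   triangular again. *)
pose s : {perm 'I_d} := perm rev_ord_inj.
have ss : (s * s = 1)%g by apply/permP=> i; rewrite permM !permE /= rev_ordK.
have sV : (s^-1 = s)%g by apply: (mulgI s); rewrite mulgV ss.
pose J : 'M[k]_d := perm_mx s.
have JJ : J *m J = 1%:M by rewrite -perm_mxM ss perm_mx1.
exists d, (row_mx 0 J); first by apply: msupp_ext_row => //; exact: msupp0.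
split=> [m u /ext_pred_decomp [u1 [u2 [-> su1 _]]]|T trT].
  exists 0, (u2 *m J); split; first exact: msupp0.
  rewrite mul0mx add0r mul_mx_row mulmx0 -mulmxA JJ mulmx1; congr row_mx.
  by apply/matrixP=> i j; rewrite su1 // mxE.
have [|a [sa ca ea]] := flag (J *m T *m J)^T.
  apply/is_trig_mxP => i j ltij; rewrite /J -{2}sV -row_permE -col_permE !mxE !permE /=.
  by move/is_trig_mxP: trT => -> //=; rewrite ltn_sub2l // (leq_ltn_trans ltij).
exists a^T, 0; split; [exact: msupp_tr| |exact: msupp0|].
  by rewrite -!trmx_mul ca.
rewrite mul0mx addr0 -(submxK a) tr_block_mx mul_row_block !mul0mx !add0r.
rewrite mul_mx_row mulmx0 ea trmxK 2!mulmxA JJ mul1mx; congr row_mx.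
apply/matrixP=> i j; rewrite [RHS]mxE mxE big1 // => l _; rewrite !mxE sa ?mulr0 //.
by rewrite /ext_rel (unsplitK (inl _ : 'I_N + 'I_d)) (unsplitK (inr _ : 'I_N + 'I_d)).
Qed.

End Extension.

(** * Paths in a quiver of type A *)

Section Reachability.
Variable o : nat -> bool.

Definition reach (i v : nat) : bool :=
  if (i <= v)%N then all o (iota i (v - i))
  else all (fun j => ~~ o j) (iota v (i - v)).

(** At most one of the two ranges is non-empty, which frees later arguments from comparing [i] and
    [v]. *)
Lemma reachP i v :
  reflect ((forall j, i <= j < v -> o j) /\ (forall j, v <= j < i -> ~~ o j))%N
          (reach i v).
Proof.
rewrite /reach; case: leqP => [le|lt]; apply: (iffP allP) => [H|[H1 H2] j].
- split=> j hj; first by apply: H; rewrite mem_iota subnKC.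
  by move: (leq_trans le (proj1 (andP hj))); rewrite leqNgt (proj2 (andP hj)).
- by rewrite mem_iota subnKC //; apply: H1.
- split=> j hj; last by apply: H; rewrite mem_iota subnKC // ltnW.
  have /andP[h1 h2] := hj; move: (ltn_trans lt (leq_ltn_trans h1 h2)).
  by rewrite ltnn.
- by rewrite mem_iota subnKC; [apply: H2|apply: ltnW].
Qed.

Lemma reach_refl i : reach i i.
Proof. by rewrite /reach leqnn subnn. Qed.

Lemma reach_trans i j l : reach i j -> reach j l -> reach i l.
Proof.
move=> /reachP [a b] /reachP [c e]; apply/reachP; split=> t /andP[h1 h2].
  by case: (ltnP t j) => h; [apply: a|apply: c]; apply/andP.
by case: (ltnP t j) => h; [apply: e|apply: b]; apply/andP.
Qed.

Lemma reach_forward i m : (i <= m)%N -> reach i m.+1 = reach i m && o m.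
Proof.
move=> le; rewrite /reach (leqW le) le subSn // -addn1 iotaD subnKC // all_cat /=.
by rewrite andbT.
Qed.

Lemma reach_backward i m : (i <= m)%N -> reach m.+1 i = reach m i && ~~ o m.
Proof.
move=> le; rewrite /reach leqNgt ltnS le /=.
have -> : (if (m <= i)%N then all o (iota m (i - m))
           else all (fun j => ~~ o j) (iota i (m - i))) =
          all (fun j => ~~ o j) (iota i (m - i)).
  case: leqP => // le'; have /eqP-> : m == i by rewrite eqn_leq le le'.
  by rewrite subnn.
by rewrite subSn // -addn1 iotaD subnKC // all_cat /= andbT.
Qed.

End Reachability.

(** * Induction over the vertices *)

Section Existence.
Variables (k : fieldType) (o : nat -> bool) (d : nat -> nat).

Fixpoint totdim (m : nat) : nat := if m is m'.+1 then totdim m' + d m' else 0.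

(** Generators are numbered by increasing vertex, so that each induction step appends the new ones
    at the end, as in [ext_rel]. *)
Fixpoint block (m : nat) : 'I_(totdim m) -> nat :=
  if m is m'.+1 return 'I_(totdim m) -> nat
  then fun p => match split p with inl p' => block p' | inr _ => m' end
  else fun=> 0.

Lemma block_lt m (p : 'I_(totdim m)) : (block p < m)%N.
Proof.
elim: m p => [[]//|m IH] p /=; case: split => [p'|_] //.
exact: leq_trans (IH p') _.
Qed.

(* Matrices act on row vectors, so [p q] entries are allowed when there is a
   path from the block of [q] to that of [p]. *)
Definition qrel N N' (blk : 'I_N -> nat) (blk' : 'I_N' -> nat) (p : 'I_N) (q : 'I_N') :=
  reach o (blk' q) (blk p).
Definition nrel N N' (blk : 'I_N -> nat) (blk' : 'I_N' -> nat) (p : 'I_N) (q : 'I_N') :=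
  qrel blk blk' p q && (blk p != blk' q).

Let orient b N (R : rel 'I_N) : rel 'I_N := fun p q => if b then R p q else R q p.
(** The generators with a path to the last vertex, or from it when [b] is false; they take the place
    of [C]. For [m = 0] the truncated predecessor is harmless, as there are no generators. *)
Let border b m : pred 'I_(totdim m) :=
  fun p => if b then reach o (block p) m.-1 else reach o m.-1 (block p).

(** Both values of [b] are carried along: the step uses the hypothesis for the direction of the
    arrow at the new vertex, and obtains the same value by [admissible_ext] and the opposite one by
    [admissible_turn]. *)
Lemma admissible_block m b :
  admissible k (orient b (qrel (@block m) (@block m))) (orient b (nrel (@block m) (@block m))) (@border b m).
Proof.
elim: m b => [|m IH] b.
  exists 0; split; first exact: msupp0.
    by move=> y _; exists 0; [exact: msupp0|apply/matrixP => -[]].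
  exists 0%N, 0; first exact: msupp0.
  split=> [m u _|T _]; last by exists 0, 0; split; try exact: msupp0; apply/matrixP => -[].
  by exists 0, 0; split; [exact: msupp0|apply/matrixP=> i []].
(* Direction of the arrow between [m.-1] and [m]; the first vertex has none, and the default is
   arbitrary. *)
pose c := if m is m'.+1 then o m' else true.
have := IH c; set R := orient _ _; set S := orient _ _; set C := @border _ _ => adm.
have trR p q r : R p q -> R q r -> R p r.
  by rewrite /R /orient /qrel; case: (c) => h1 h2; [apply: reach_trans h2 h1|apply: reach_trans h1 h2].
have subSR p q : S p q -> R p q by rewrite /S /R /orient; case: (c) => /andP[].
have closC p q : C p -> R p q -> C q.
  by rewrite /C /R /border /orient /qrel; case: (c) => h1 h2; [apply: reach_trans h2 h1|apply: reach_trans h1 h2].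
have lastT (p : 'I_(totdim m)) : reach o (block p) m = c && C p.
  move: p; rewrite /C /border /c; clear; case: m => [[]//|m'] p; rewrite reach_forward; last by rewrite -ltnS block_lt.
  by case: (o m'); rewrite ?andbT ?andbF.
have lastF (p : 'I_(totdim m)) : reach o m (block p) = ~~ c && C p.
  move: p; rewrite /C /border /c; clear; case: m => [[]//|m'] p; rewrite reach_backward; last by rewrite -ltnS block_lt.
  by case: (o m'); rewrite ?andbT ?andbF.
have neqm (p : 'I_(totdim m)) : (m == block p) = false by rewrite gtn_eqF ?block_lt.
have eR : orient c (qrel (@block m.+1) (@block m.+1)) =2 ext_rel R C true.
  move=> p q; rewrite /orient /qrel /ext_rel /R /orient /qrel /=.
  by case: (split p) => p'; case: (split q) => q'; rewrite ?reach_refl ?lastT ?lastF; case: (c).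
have eS : orient c (nrel (@block m.+1) (@block m.+1)) =2 ext_rel S C false.
  move=> p q; rewrite /orient /nrel /qrel /ext_rel /S /orient /nrel /qrel /=.
  by case: (split p) => p'; case: (split q) => q';
     rewrite ?reach_refl ?lastT ?lastF ?eqxx ?(eq_sym (block _) m) ?neqm; case: (c); rewrite /= ?andbT.
have [<-|nbc] := eqVneq c b.
  have [x [sx rx fx _]] := admissible_ext trR subSR closC (d m) adm.
  apply: (@admissible_eq _ _ _ _ _ _ (ext_pred C true)); last by exists x; split; eassumption.
  - by move=> p q; rewrite eR.
  - by move=> p q; rewrite eS.
  move=> p; rewrite /ext_pred /border /=; case: (split p) => p';
  by rewrite ?reach_refl ?lastT ?lastF; case: (c).
have eb : b = ~~ c by case: (b) (c) nbc => [] [].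
have := admissible_turn trR subSR closC (d m) adm.
apply: admissible_eq => [p q|p q|p].
- by rewrite -eR eb /orient; case: (c).
- by rewrite -eS eb /orient; case: (c).
rewrite /ext_pred /border eb /=; case: (split p) => p';
  by rewrite ?reach_refl ?lastT ?lastF; case: (c).
Qed.

Lemma exists_rigid m : exists2 x : 'M[k]_(totdim m),
  msupp (nrel (@block m) (@block m)) x & rigid (qrel (@block m) (@block m)) (nrel (@block m) (@block m)) x.
Proof. by have [x [sx rx _]] := admissible_block m true; exists x. Qed.

End Existence.

(** * Uniqueness of the rigid orbit *)

Section PolynomialFunctions.
Variable k : fieldType.

Definition polyfun (f : k -> k) : Prop := exists p : {poly k}, forall t, f t = p.[t].
Definition polymx m n (A : k -> 'M[k]_(m, n)) : Prop :=
  forall i j, polyfun (fun t => A t i j).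

Lemma polyfun_ext f g : f =1 g -> polyfun f -> polyfun g.
Proof. by move=> e [p hp]; exists p => t; rewrite -e. Qed.

Lemma polyfun_const c : polyfun (fun=> c).
Proof. by exists c%:P => t; rewrite hornerC. Qed.

Lemma polyfun_id : polyfun id.
Proof. by exists 'X => t; rewrite hornerX. Qed.

Lemma polyfunD f g : polyfun f -> polyfun g -> polyfun (fun t => f t + g t).
Proof. by move=> [p hp] [q hq]; exists (p + q) => t; rewrite hornerD hp hq. Qed.

Lemma polyfunM f g : polyfun f -> polyfun g -> polyfun (fun t => f t * g t).
Proof. by move=> [p hp] [q hq]; exists (p * q) => t; rewrite hornerM hp hq. Qed.

Lemma polyfun_sum (I : Type) (r : seq I) (P : pred I) (F : I -> k -> k) :
  (forall i, polyfun (F i)) -> polyfun (fun t => \sum_(i <- r | P i) F i t).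
Proof.
move=> hF; elim: r => [|i r IH].
  by apply: polyfun_ext (polyfun_const 0) => t; rewrite big_nil.
case Pi: (P i).
  by apply: polyfun_ext (polyfunD (hF i) IH) => t; rewrite big_cons Pi.
by apply: polyfun_ext IH => t; rewrite big_cons Pi.
Qed.

Lemma polyfun_prod (I : Type) (r : seq I) (P : pred I) (F : I -> k -> k) :
  (forall i, polyfun (F i)) -> polyfun (fun t => \prod_(i <- r | P i) F i t).
Proof.
move=> hF; elim: r => [|i r IH].
  by apply: polyfun_ext (polyfun_const 1) => t; rewrite big_nil.
case Pi: (P i).
  by apply: polyfun_ext (polyfunM (hF i) IH) => t; rewrite big_cons Pi.
by apply: polyfun_ext IH => t; rewrite big_cons Pi.
Qed.

Lemma polymx_const m n (A : 'M[k]_(m, n)) : polymx (fun=> A).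
Proof. by move=> i j; apply: polyfun_const. Qed.

Lemma polymxD m n (A B : k -> 'M[k]_(m, n)) :
  polymx A -> polymx B -> polymx (fun t => A t + B t).
Proof.
by move=> hA hB i j; apply: polyfun_ext (polyfunD (hA i j) (hB i j)) => t; rewrite mxE.
Qed.

Lemma polymxZ m n (c : k -> k) (A : k -> 'M[k]_(m, n)) :
  polyfun c -> polymx A -> polymx (fun t => c t *: A t).
Proof.
by move=> hc hA i j; apply: polyfun_ext (polyfunM hc (hA i j)) => t; rewrite mxE.
Qed.

Lemma polymxM m n p (A : k -> 'M[k]_(m, n)) (B : k -> 'M[k]_(n, p)) :
  polymx A -> polymx B -> polymx (fun t => A t *m B t).
Proof.
move=> hA hB i j.
apply: polyfun_ext (polyfun_sum _ _ (fun l => polyfunM (hA i l) (hB l j))) => t.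
by rewrite mxE.
Qed.

Lemma polymx_det n (A : k -> 'M[k]_n) : polymx A -> polyfun (fun t => \det (A t)).
Proof.
move=> hA; rewrite /determinant; apply: polyfun_sum => s.
by apply: polyfunM; [apply: polyfun_const|apply: polyfun_prod].
Qed.

(** The adjugate stands in for the inverse, whose entries are only rational functions of the
    parameter. *)
Lemma polymx_adj n (A : k -> 'M[k]_n) : polymx A -> polymx (fun t => \adj (A t)).
Proof.
move=> hA i j; apply: (@polyfun_ext (fun t => cofactor (A t) j i)) => [t|]; first by rewrite mxE.
apply: polyfunM; first exact: polyfun_const.
apply: polymx_det => a b.
by apply: polyfun_ext (hA (lift j a) (lift i b)) => t; rewrite !mxE.
Qed.

End PolynomialFunctions.

Section Conjugacy.
Variables (k : closedFieldType) (N : nat) (R S : rel 'I_N).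
Hypotheses (reflR : forall p, R p p)
  (RS : forall p q r, R p q -> S q r -> S p r)
  (SR : forall p q r, S p q -> R q r -> S p r).

(* Near [x] the kernel of [a |-> a x - z a] contains a matrix close to [1]: it
   is obtained from [1] by correcting with a linear section of the surjective
   map at [z = x], and Cramer's rule makes the correction polynomial in the
   parameter of a line. *)
Lemma rigid_generic (u v : 'M[k]_N) (t0 : k) :
  msupp S u -> msupp S v -> rigid R S (u + t0 *: v) ->
  exists2 p : {poly k}, p != 0 & forall t, p.[t] != 0 ->
    exists g, [/\ msupp R g, g \in unitmx & g *m (u + t0 *: v) = (u + t *: v) *m g].
Proof.
move=> su sv; set x := u + t0 *: v => rx.
pose z t := u + t *: v.
have sz t : msupp S (z t).
  by apply: msuppD => // i j h; rewrite mxE sv // mulr0.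
(* [P] projects vectorised matrices onto those supported on [S]. *)
pose P : 'M[k]_(N * N) := diag_mx (mxvec (\matrix_(p, q) (S p q)%:R)).
have fixP y : msupp S y -> mxvec y *m P = mxvec y.
  move=> sy; apply/rowP=> i; rewrite mul_mx_diag mxE.
  case/mxvec_indexP: i => p q; rewrite !mxvecE mxE.
  by case: (boolP (S p q)) => [_|/sy->]; rewrite ?mulr1 ?mul0r.
have PP : P *m P = P.
  apply/matrixP=> i j; rewrite mul_mx_diag !mxE; case: eqP => [->|_]; rewrite ?mul0r //.
  by case/mxvec_indexP: j => p q; rewrite mxvecE mxE mulr1n; case: (S p q); rewrite !(mulr0, mulr1).
have [G hG] : exists G : 'I_(N * N) -> 'M[k]_N, forall i,
    msupp R (G i) /\ G i *m x - x *m G i = vec_mx (row i P).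
  have /fin_all_exists [G hG] i : exists a, msupp R a /\ a *m x - x *m a = vec_mx (row i P).
    have [|a sa ea] := rx (vec_mx (row i P)); last by exists a.
    move=> p q nS; rewrite !mxE; case/mxvec_indexP: i => p' q'.
    case: eqP => [->|_]; last by rewrite mulr0n.
    by rewrite mxvecE mxE (negbTE nS).
  by exists G.
(* The rows of [GM] are chosen preimages, so [GM] is a linear section of the map at [t0]. *)
pose GM : 'M[k]_(N * N) := \matrix_i mxvec (G i).
have sGM (w : 'rV_(N * N)) : msupp R (vec_mx (w *m GM)).
  move=> p q nR; rewrite !mxE big1 // => i _.
  by rewrite !mxE mxvecE (proj1 (hG i)) // mulr0.
pose L t : 'M[k]_(N * N) := lin_mulmxr x - lin_mulmx (z t).
have LE t a : mxvec a *m L t = mxvec (a *m x - z t *m a).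
  by rewrite mulmxBr !mul_vec_lin linearB.
have GL0 : GM *m L t0 = P.
  by apply/row_matrixP=> i; rewrite row_mul rowK LE (proj2 (hG i)) vec_mxK.
have GLP t : GM *m L t *m P = GM *m L t.
  apply/row_matrixP=> i; rewrite row_mul row_mul rowK LE fixP //.
  have [sG _] := hG i; apply: msuppD; last apply: msuppN.
    exact: (msuppM RS sG (sz t0)).
  exact: (msuppM SR (sz t) sG).
(* Adding [1%:M - P] gives a square matrix equal to 1 at [t0], to which Cramer's rule applies. *)
pose D t := GM *m L t + (1%:M - P).
pose r t := mxvec (x - z t).
have rE t : mxvec 1%:M *m L t = r t by rewrite LE mul1mx mulmx1.
have rP t : r t *m P = r t by apply/fixP/msuppD; [exact: sz t0|apply/msuppN].
(* [r t] is the value of the map at 1, and [r t *m invmx (D t) *m GM] would be a preimage of it;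
   subtracting this from 1 lands in the kernel, and the determinant clears the denominators. *)
pose g t := vec_mx (\det (D t) *: mxvec 1%:M - r t *m \adj (D t) *m GM).
have sg t : msupp R (g t).
  rewrite /g linearB /= linearZ /= mxvecK; apply: msuppD; last exact/msuppN/sGM.
  move=> p q nR; rewrite !mxE; case: eqP nR => [->|_ _]; last by rewrite mulr0.
  by rewrite reflR.
have gE t : g t *m x = z t *m g t.
  apply/eqP; rewrite -subr_eq0 -mxvec_eq0 -LE /g vec_mxK mulmxBl -scalemxAl rE.
  have DP : D t *m (1%:M - P) = 1%:M - P.
    rewrite mulmxDl mulmxBr mulmx1 GLP subrr add0r.
    by rewrite mulmxBr mulmx1 mulmxBl mul1mx PP subrr subr0.
  have aP : \adj (D t) *m (1%:M - P) = \det (D t) *: (1%:M - P).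
    by rewrite -{1}DP mulmxA mul_adj_mx mul_scalar_mx.
  have -> : r t *m \adj (D t) *m GM *m L t = \det (D t) *: r t.
    have -> : r t *m \adj (D t) *m GM *m L t =
        r t *m (\adj (D t) *m D t - \adj (D t) *m (1%:M - P)).
      by rewrite -mulmxBr /D addrK !mulmxA.
    rewrite mul_adj_mx aP mulmxBr mul_mx_scalar -scalemxAr mulmxBr mulmx1 rP.
    by rewrite subrr scaler0 subr0.
  by rewrite subrr.
have pD : polymx D.
  apply: polymxD; last exact: polymx_const.
  apply: polymxM; first exact: polymx_const.
  move=> i j; apply: (@polyfun_ext _ (fun t => (lin_mulmxr x - lin_mulmx u - t *: lin_mulmx v) i j)).
    by move=> t; rewrite /L /z [lin_mulmx (u + _)]linearD /= [lin_mulmx (t *: v)]linearZ /= opprD addrA.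
  apply: polymxD; first exact: polymx_const.
  move=> a b; apply: (@polyfun_ext _ (fun t => (- lin_mulmx v a b) * t)) => [t|].
    by rewrite !mxE mulNr mulrC.
  by apply: polyfunM; [exact: polyfun_const|exact: polyfun_id].
have pr : polymx r.
  move=> i j; apply: (@polyfun_ext _ (fun t => (mxvec (x - u) - t *: mxvec v) i j)).
    by move=> t; rewrite /r /z [- (u + _)]opprD addrA [mxvec (x - u - _)]linearB /= [mxvec (t *: v)]linearZ.
  apply: polymxD; first exact: polymx_const.
  move=> a b; apply: (@polyfun_ext _ (fun t => (- mxvec v a b) * t)) => [t|].
    by rewrite !mxE mulNr mulrC.
  by apply: polyfunM; [exact: polyfun_const|exact: polyfun_id].
have pg : polymx g.
  move=> p q; apply: (@polyfun_ext _
    (fun t => (\det (D t) *: mxvec 1%:M + (-1) *: (r t *m \adj (D t) *m GM)) 0 (mxvec_index p q))).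
    by move=> t; rewrite /g scaleN1r [RHS]mxE.
  apply: polymxD.
    by apply: polymxZ; [apply: polymx_det|apply: polymx_const].
  apply: polymxZ; first exact: polyfun_const.
  by apply: polymxM; [apply: polymxM => //; apply: polymx_adj|apply: polymx_const].
(* The polynomial is non-zero because [g t0 = 1]. *)
have [p hp] := polymx_det pg; exists p.
  apply: contra_neq (oner_neq0 k) => p0.
  have D0 : D t0 = 1%:M by rewrite /D GL0 addrC subrK.
  have r0 : r t0 = 0 by rewrite /r subrr linear0.
  have g0 : g t0 = 1%:M by rewrite /g r0 !mul0mx subr0 D0 det1 scale1r mxvecK.
  by rewrite -(det1 k N) -g0 hp p0 horner0.
move=> t; rewrite -hp => nz; exists (g t); split=> //.
by rewrite unitmxE unitfE.
Qed.

Lemma rigid_conjugate (x y : 'M[k]_N) :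
  msupp S x -> msupp S y -> rigid R S x -> rigid R S y ->
  exists g h, [/\ msupp R g, msupp R h, g \in unitmx, h \in unitmx &
    exists2 z, msupp S z & g *m x = z *m g /\ h *m y = z *m h].
Proof.
move=> sx sy rx ry; have sv : msupp S (y - x) by apply: msuppD => //; apply: msuppN.
have [|p p0 hp] := @rigid_generic x (y - x) 0 sx sv; first by rewrite scale0r addr0.
have [|q q0 hq] := @rigid_generic x (y - x) 1 sx sv.
  by rewrite scale1r addrCA subrr addr0.
(* The points [x] and [y] have parameters 0 and 1; over an algebraically closed field the product of
   both polynomials has a non-root. *)
have /closed_nonrootP [t] : p * q != 0 by rewrite mulf_neq0.
rewrite rootE hornerM mulf_eq0 negb_or => /andP[/hp [g [sg ug eg]] /hq [h [sh uh eh]]].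
exists g, h; split=> //; exists (x + t *: (y - x)).
  by apply: msuppD => // i j nS; rewrite mxE sv // mulr0.
by move: eg eh; rewrite scale0r addr0 scale1r addrCA subrr addr0.
Qed.

End Conjugacy.

(** * Standard modules *)

Section Arrows.
Variables (o : nat -> bool) (n : nat).

(** Arrows of the quiver in either direction; working with them instead of [rF] and [rB] makes the
    later arguments uniform in the orientation. *)
Definition arr (u v : nat) : bool :=
  [&& (u < n)%N, (v < n)%N & ((v == u.+1) && o u) || ((u == v.+1) && ~~ o v)].

Lemma arr_ltl u v : arr u v -> (u < n)%N.
Proof. by case/and3P. Qed.

Lemma arr_ltr u v : arr u v -> (v < n)%N.
Proof. by case/and3P. Qed.

Variant arr_spec : nat -> nat -> Prop :=
  | ArrF j of (j.+1 < n)%N & o j : arr_spec j j.+1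
  | ArrB j of (j.+1 < n)%N & ~~ o j : arr_spec j.+1 j.

Lemma arrP u v : reflect (arr_spec u v) (arr u v).
Proof.
apply: (iffP and3P) => [[ltu ltv]|].
  by case/orP => /andP[/eqP e oe]; subst; [apply: ArrF|apply: ArrB].
by case=> j ltj oj; rewrite ltj (ltnW ltj) eqxx oj ?orbT.
Qed.

Lemma arr_reach u v : arr u v -> reach o u v.
Proof.
case/arrP => j _ oj; first by rewrite reach_forward // reach_refl oj.
by rewrite reach_backward // reach_refl oj.
Qed.

Lemma reach_arr i u v : arr u v -> reach o i u -> reach o i v.
Proof. by move=> /arr_reach h1 h2; apply: reach_trans h2 h1. Qed.

Lemma reach_antisym i j : reach o i j -> reach o j i -> i = j.
Proof.
have aux a b : (a < b)%N -> reach o a b -> reach o b a -> False.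
  move=> lt /reachP[h _] /reachP[_ h'].
  by have := h' a; rewrite leqnn lt h // ?leqnn // => /(_ isT).
by case: (ltngtP i j) => // lt h1 h2; [case: (aux i j)|case: (aux j i)].
Qed.

Lemma reach_arrF i u v : arr u v -> reach o i u -> i != v.
Proof.
move=> auv riu; apply/eqP => e; subst i.
move: auv (reach_antisym riu (arr_reach auv)) => /arrP[] j _ _ /eqP.
  by rewrite gtn_eqF.
by rewrite ltn_eqF.
Qed.

Lemma reach_pred i v : (i < n)%N -> (v < n)%N -> reach o i v -> i != v ->
  exists2 u, arr u v & reach o i u.
Proof.
move=> lti ltv riv; case: ltngtP => // lt _.
  case: v ltv lt riv => // v ltv lt; rewrite reach_forward // => /andP[riv ov].
  by exists v => //; apply/arrP/ArrF.
exists v.+1.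
  apply/arrP/ArrB; first exact: leq_ltn_trans lti.
  by case/reachP: riv => _; apply; rewrite leqnn.
apply/reachP; case/reachP: riv => h1 h2; split=> j /andP[a b].
  by move: (leq_trans lt a); rewrite leqNgt ltnS -ltnS b.
by apply: h2; rewrite b (ltnW a).
Qed.

(** Two different arrows into [v] come from opposite sides, and a path from [i] can arrive from one
    side only. *)
Lemma reach_pred_uniq i u w v : arr u v -> arr w v ->
  reach o i u -> reach o i w -> u = w.
Proof.
have aux j : o j -> ~~ o j.+1 -> reach o i j -> reach o i j.+2 -> False.
  move=> oj oj' /reachP[_ h] /reachP[h' _].
  have [le|lt] := leqP i j.
    by move: oj'; rewrite h' // ltnSn (leq_trans le).
  by move: oj; apply/negP/h; rewrite leqnn lt.
case/arrP=> j ltj oj /and3P[_ _ /orP[]/andP[/eqP e oe]] r1 r2; subst.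
- by case: e.
- by case: (aux _ oj oe).
- by case: (aux _ oe oj).
- by [].
Qed.

(** A measure that increases along arrows, for inductions where the numbering of the vertices may go
    either way. *)
Definition depth v := #|[set i : 'I_n | reach o i v]|.

Lemma arr_depth u v : arr u v -> (depth u < depth v)%N.
Proof.
move=> auv; apply: proper_card; apply/properP; split.
  by apply/subsetP=> i; rewrite !inE; apply: reach_arr.
exists (Ordinal (arr_ltr auv)); rewrite inE ?reach_refl //=.
by apply/negP => /(reach_arrF auv); rewrite eqxx.
Qed.

Lemma reach_ind i (P : nat -> Prop) : (i < n)%N -> P i ->
  (forall u v, arr u v -> reach o i u -> P u -> P v) ->
  forall v, (v < n)%N -> reach o i v -> P v.
Proof.
move=> lti Pi IH v; move: {2}(depth v) (leqnn (depth v)) => m.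
elim: m v => [|m IHm] v lev ltv riv.
  move: lev; rewrite leqn0 cards_eq0 => /eqP/setP/(_ (Ordinal ltv)).
  by rewrite !inE reach_refl.
have [<-//|niv] := eqVneq i v.
have [u auv riu] := reach_pred lti ltv riv niv.
apply: (IH u) => //; apply: IHm (arr_ltl auv) riu.
by rewrite -ltnS; apply: leq_trans lev; apply: arr_depth.
Qed.

End Arrows.

Section Maps.
Variables (k : fieldType) (o : nat -> bool) (n : nat).
Local Notation arr := (arr o n).

(* [conform_mx 0] is only a cast: the dimensions agree in the branches taken.
   For non-adjacent vertices the value is the junk [0]. *)
Definition mp (M : rep k) (u v : nat) : 'M[k]_(rdim M u, rdim M v) :=
  if v == u.+1 then conform_mx 0 (rF M u)
  else if u == v.+1 then conform_mx 0 (rB M v) else 0.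

Lemma mpF M j : mp M j j.+1 = rF M j.
Proof. by rewrite /mp eqxx conform_mx_id. Qed.

Lemma mpB M j : mp M j.+1 j = rB M j.
Proof. by rewrite /mp ltn_eqF ?eqxx ?conform_mx_id // ltnS leqnSn. Qed.

(* [sum_gamma gamma gamma^*], acting on row vectors. *)
Definition loop (M : rep k) (v : nat) : 'M[k]_(rdim M v) :=
  \sum_(w < n | arr w v) mp M v w *m mp M w v.

(** The relations (1) and (2) for all arrows at once, without the case distinction by orientation in
    [is_Dmod]. *)
Definition Dmod (M : rep k) : Prop :=
  [/\ forall v, (n <= v)%N -> rdim M v = 0%N,
      forall u v, arr u v -> mp M u v *m mp M v u = loop M u
    & forall u w v, arr u v -> arr w v -> u != w -> mp M u v *m mp M v w = 0].

Lemma loop1 M u v : arr u v -> (forall w, arr w v -> w = u) ->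
  loop M v = mp M v u *m mp M u v.
Proof.
move=> auv uniq; rewrite /loop (big_pred1 (Ordinal (arr_ltl auv))) // => w /=.
by apply/idP/eqP => [/uniq e|->//]; apply: val_inj.
Qed.

Lemma loop0 M v : (forall w, ~~ arr w v) -> loop M v = 0.
Proof. by move=> h; rewrite /loop big_pred0 // => w; apply/negbTE. Qed.

Lemma loop_source M i : (i.+2 < n)%N -> o i.+1 ->
  loop M i.+1 = if o i then rB M i *m rF M i else 0.
Proof.
move=> lt oi; case: ifP => oi'.
  rewrite (@loop1 _ i) ?mpF ?mpB //; first by apply/arrP/ArrF/oi'/ltnW.
  by move=> w /and3P[_ _ /orP[]/andP[/eqP e oe]]; [case: e|move: oe; rewrite oi].
rewrite loop0 // => w; apply/negP => /and3P[_ _ /orP[]/andP[/eqP e oe]].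
  by case: e oe => <-; rewrite oi'.
by move: oe; rewrite oi.
Qed.

Lemma loop_source0 M : o 0%N -> loop M 0 = 0.
Proof.
move=> o0; rewrite loop0 // => w; apply/negP => /and3P[_ _ /orP[]/andP[/eqP e oe]] //.
by move: oe; rewrite o0.
Qed.

Lemma loop_sink M j : (j.+1 < n)%N -> ~~ o j ->
  loop M j.+1 = if (j.+2 < n)%N && ~~ o j.+1 then rF M j.+1 *m rB M j.+1 else 0.
Proof.
move=> lt oj; case: ifP => [/andP[lt' oj']|h].
  rewrite (@loop1 _ j.+2) ?mpF ?mpB //; first by apply/arrP/ArrB.
  by move=> w /and3P[_ _ /orP[]/andP[/eqP e oe]] //; case: e oe => <-; rewrite (negbTE oj).
rewrite loop0 // => w; apply/negP => /and3P[ltw _ /orP[]/andP[/eqP e oe]].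
  by case: e oe => <-; rewrite (negbTE oj).
by move: h; rewrite -e ltw oe.
Qed.

Lemma DmodP M : is_Dmod n o M <-> Dmod M.
Proof.
split=> [[d0 r2 r3 r4 r5]|[d0 r1 r2]].
  split=> // [u v|u w v].
    case/arrP=> j lt oj; rewrite mpF mpB; last by rewrite r4 // loop_sink.
    case: j lt oj => [|i] lt oi; first by rewrite r2 // loop_source0.
    by rewrite r3 // loop_source.
  case/arrP=> j lt oj /and3P[ltw _ /orP[]/andP[/eqP e oe]] nuw; subst.
  - by case: e nuw => ->; rewrite eqxx.
  - by rewrite !mpF; case: (r5 j).
  - by rewrite !mpB; case: (r5 w).
  - by rewrite eqxx in nuw.
split=> //.
- by move=> o0 lt; rewrite -mpF -mpB r1 ?loop_source0 //; apply/arrP/ArrF.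
- by move=> i lt oi; rewrite -loop_source // -(r1 _ i.+2) ?mpF ?mpB //; apply/arrP/ArrF.
- by move=> j lt oj; rewrite -loop_sink // -(r1 _ j) ?mpF ?mpB //; apply/arrP/ArrB.
move=> i lt oi oi'; have a1 : arr i i.+1 by apply/arrP/ArrF/oi/ltnW.
have a2 : arr i.+2 i.+1 by apply/arrP/ArrB.
rewrite -!mpF -!mpB; split; apply: r2 => //.
  by rewrite ltn_eqF // ltnS leqnSn.
by rewrite gtn_eqF // ltnS leqnSn.
Qed.

Definition ahom (M N : rep k) (f : forall v, 'M[k]_(rdim M v, rdim N v)) : Prop :=
  forall u v, arr u v -> mp M u v *m f v = f u *m mp N u v.

Lemma is_hom_ahom (M N : rep k) (f : forall v, 'M[k]_(rdim M v, rdim N v)) :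
  is_hom f -> ahom f.
Proof.
by move=> h u v /arrP[] j _ _; rewrite ?mpF ?mpB; case: (h j).
Qed.

Lemma is_hom_star (M N : rep k) (f : forall v, 'M[k]_(rdim M v, rdim N v)) u v :
  is_hom f -> arr u v -> mp M v u *m f u = f v *m mp N v u.
Proof.
by move=> h /arrP[] j _ _; rewrite ?mpF ?mpB; case: (h j).
Qed.

Lemma mx0dim m1 m2 (A B : 'M[k]_(m1, m2)) : (m1 = 0%N) \/ (m2 = 0%N) -> A = B.
Proof.
case=> e; subst; [by rewrite [A]flatmx0 [B]flatmx0|by rewrite [A]thinmx0 [B]thinmx0].
Qed.

(** The squares beyond the last vertex commute because they involve a zero space. *)
Lemma is_homP (M N : rep k) (f : forall v, 'M[k]_(rdim M v, rdim N v)) :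
  (forall v, (n <= v)%N -> rdim M v = 0%N) -> (forall v, (n <= v)%N -> rdim N v = 0%N) ->
  ahom f -> (forall u v, arr u v -> mp M v u *m f u = f v *m mp N v u) -> is_hom f.
Proof.
move=> dM dN h1 h2 j; have [le|lt] := leqP n j.+1.
  by split; apply: mx0dim; [right; apply: dN|left; apply: dM].
rewrite -!mpF -!mpB; case: (boolP (o j)) => oj.
  have a : arr j j.+1 by apply/arrP/ArrF.
  by split; [apply: h1|apply: h2].
have a : arr j.+1 j by apply/arrP/ArrB.
by split; [apply: h2|apply: h1].
Qed.

Lemma isomorphicP (M N : rep k) (f : forall v, 'M[k]_(rdim M v, rdim N v))
    (g : forall v, 'M[k]_(rdim N v, rdim M v)) :
  is_hom f -> (forall v, f v *m g v = 1%:M) -> (forall v, g v *m f v = 1%:M) ->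
  isomorphic M N.
Proof.
move=> hf fg gf; exists f, g; split=> //; split=> // j; have [h1 h2] := hf j.
split.
  by rewrite -[LHS]mul1mx -(gf j) -mulmxA (mulmxA (f j)) -h1 -!mulmxA fg mulmx1.
by rewrite -[LHS]mul1mx -(gf j.+1) -mulmxA (mulmxA (f j.+1)) -h2 -!mulmxA fg mulmx1.
Qed.

Lemma isomorphic_sym (M N : rep k) : isomorphic M N -> isomorphic N M.
Proof. by case=> f [g [hf [hg e]]]; exists g, f; do !split=> //; case: (e v). Qed.

Lemma is_hom_comp (M N P : rep k) (f : forall v, 'M[k]_(rdim M v, rdim N v))
    (g : forall v, 'M[k]_(rdim N v, rdim P v)) :
  is_hom f -> is_hom g -> is_hom (fun v => f v *m g v).
Proof.
move=> hf hg j; have [f1 f2] := hf j; have [g1 g2] := hg j.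
by split; [rewrite mulmxA f1 -mulmxA g1|rewrite mulmxA f2 -mulmxA g2]; rewrite mulmxA.
Qed.

Lemma isomorphic_trans (M N P : rep k) :
  isomorphic M N -> isomorphic N P -> isomorphic M P.
Proof.
case=> f [g [hf [hg e]]] [f' [g' [hf' [hg' e']]]].
apply: (isomorphicP (g := fun v => g' v *m g v) (is_hom_comp hf hf')) => v.
  by rewrite -mulmxA (mulmxA (f' v)) (proj1 (e' v)) mul1mx (proj1 (e v)).
by rewrite -mulmxA (mulmxA (g v)) (proj2 (e v)) mul1mx (proj2 (e' v)).
Qed.

End Maps.

(** * Blocks of matrices indexed by subsets *)

Section Restriction.
Variable k : fieldType.

Definition incl N (A : {set 'I_N}) : 'M[k]_(#|A|, N) := rowsub enum_val 1%:M.

(** A submatrix written as a product with inclusions, so that identities between blocks reduce to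
    associativity and to conditions on supports. *)
Definition res N N' (A : {set 'I_N}) (B : {set 'I_N'}) (a : 'M[k]_(N, N')) :
  'M[k]_(#|A|, #|B|) := incl A *m a *m (incl B)^T.

Lemma inclE N (A : {set 'I_N}) m (a : 'M[k]_(N, m)) : incl A *m a = rowsub enum_val a.
Proof. by rewrite mul_rowsub_mx mul1mx. Qed.

Lemma incl_eq N (A : {set 'I_N}) m (a b : 'M[k]_(N, m)) :
  (forall p, p \in A -> row p a = row p b) -> incl A *m a = incl A *m b.
Proof.
by move=> h; rewrite !inclE; apply/row_matrixP=> i; rewrite !row_rowsub h ?enum_valP.
Qed.

Lemma inclK N (A : {set 'I_N}) : incl A *m (incl A)^T = 1%:M.
Proof.
rewrite inclE; apply/matrixP=> i j; rewrite !mxE eq_sym.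
by rewrite (inj_eq enum_val_inj).
Qed.

Lemma incl_proj N (A : {set 'I_N}) p q :
  ((incl A)^T *m incl A) p q = ((p \in A) && (p == q))%:R.
Proof.
transitivity (\sum_(r in A) (r == p)%:R * (r == q)%:R : k).
  by rewrite big_enum_val mxE; apply: eq_bigr => i _; rewrite !mxE.
rewrite big_mkcond (bigD1 p) //= eqxx mul1r big1 => [|r /negbTE->].
  by rewrite addr0; case: (p \in A).
by rewrite mul0r if_same.
Qed.

Lemma incl_projr N (A : {set 'I_N}) m (a : 'M[k]_(m, N)) p q :
  (a *m ((incl A)^T *m incl A)) p q = a p q * (q \in A)%:R.
Proof.
rewrite mxE (bigD1 q) //= incl_proj eqxx andbT big1 ?addr0 // => r /negbTE nrq.
by rewrite incl_proj nrq andbF mulr0.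
Qed.

Lemma row_incl_proj N (A : {set 'I_N}) m (a : 'M[k]_(N, m)) p :
  p \in A -> row p ((incl A)^T *m incl A *m a) = row p a.
Proof.
move=> pA; rewrite row_mul (_ : row p _ = row p 1%:M) -?row_mul ?mul1mx //.
by apply/rowP=> q; rewrite [LHS]mxE [RHS]mxE incl_proj pA mxE.
Qed.

Lemma incl_supp N N' (A : {set 'I_N}) (B : {set 'I_N'}) (a : 'M[k]_(N, N')) :
  (forall p q, p \in A -> q \notin B -> a p q = 0) ->
  incl A *m a *m (incl B)^T *m incl B = incl A *m a.
Proof.
move=> h; rewrite -2!mulmxA; apply: incl_eq => p pA; apply/rowP=> q.
rewrite [LHS]mxE [RHS]mxE incl_projr.
by case: (boolP (q \in B)) => qB; rewrite ?mulr1 // h ?mul0r.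
Qed.

Lemma inclS N (A B : {set 'I_N}) : A \subset B -> incl A *m (incl B)^T *m incl B = incl A.
Proof.
move=> /subsetP sAB; rewrite -[in LHS](mulmx1 (incl A)) incl_supp ?mulmx1 // => p q pA.
by apply: contraNeq; rewrite mxE; case: (p =P q) => [<- _|_]; [apply: sAB|rewrite eqxx].
Qed.

Lemma resE N N' (A : {set 'I_N}) (B : {set 'I_N'}) (a : 'M[k]_(N, N')) i j :
  res A B a i j = a (enum_val i) (enum_val j).
Proof.
rewrite /res inclE mxE (bigD1 (enum_val j)) //= !mxE eqxx mulr1 big1 ?addr0 // => q.
by rewrite !mxE eq_sym => /negbTE->; rewrite mulr0.
Qed.

Lemma res_eqP N N' (A : {set 'I_N}) (B : {set 'I_N'}) (a b : 'M[k]_(N, N')) :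
  res A B a = res A B b <-> (forall p q, p \in A -> q \in B -> a p q = b p q).
Proof.
split=> [e p q pA qB|h]; last by apply/matrixP=> i j; rewrite !resE h ?enum_valP.
move/matrixP: e => /(_ (enum_rank_in pA p) (enum_rank_in qB q)).
by rewrite !resE !enum_rankK_in.
Qed.

Lemma res_mul_cond N N' N'' (A : {set 'I_N}) (B : {set 'I_N'}) (C : {set 'I_N''})
    (a : 'M[k]_(N, N')) (b : 'M[k]_(N', N'')) :
  (forall p q r, p \in A -> q \notin B -> r \in C -> a p q * b q r = 0) ->
  res A B a *m res B C b = res A C (a *m b).
Proof.
move=> h; apply/matrixP=> i j; rewrite resE !mxE.
transitivity (\sum_(q in B) a (enum_val i) q * b q (enum_val j)).
  by rewrite [RHS]big_enum_val; apply: eq_bigr => l _; rewrite !resE.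
rewrite [LHS]big_mkcond /=; apply: eq_bigr => q _; case: ifPn => // qB.
by rewrite h ?enum_valP.
Qed.

Lemma res_mul N N' N'' (A : {set 'I_N}) (B : {set 'I_N'}) (C : {set 'I_N''})
    (a : 'M[k]_(N, N')) (b : 'M[k]_(N', N'')) :
  (forall p q, p \in A -> q \notin B -> a p q = 0) ->
  res A B a *m res B C b = res A C (a *m b).
Proof. by move=> h; apply: res_mul_cond => p q r pA qB _; rewrite h ?mul0r. Qed.

Lemma res1_mul N N' (A B : {set 'I_N}) (C : {set 'I_N'}) (b : 'M[k]_(N, N')) :
  A \subset B -> res A B 1%:M *m res B C b = res A C b.
Proof. by move=> h; rewrite /res mulmx1 !mulmxA inclS. Qed.

Lemma res1 N (A : {set 'I_N}) : res A A 1%:M = 1%:M.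
Proof. by rewrite /res mulmx1 inclK. Qed.

Lemma resD N N' (A : {set 'I_N}) (B : {set 'I_N'}) (a b : 'M[k]_(N, N')) :
  res A B (a + b) = res A B a + res A B b.
Proof. by rewrite /res mulmxDr mulmxDl. Qed.

Lemma resB N N' (A : {set 'I_N}) (B : {set 'I_N'}) (a b : 'M[k]_(N, N')) :
  res A B (a - b) = res A B a - res A B b.
Proof. by rewrite /res mulmxBr mulmxBl. Qed.

Lemma res0 N N' (A : {set 'I_N}) (B : {set 'I_N'}) :
  res A B (0 : 'M[k]_(N, N')) = 0.
Proof. by rewrite /res mulmx0 mul0mx. Qed.

End Restriction.

Section Standard.
Variables (k : fieldType) (o : nat -> bool) (n : nat).
Local Notation arr := (arr o n).
Local Notation mp := (@mp k).
Local Notation loop := (@loop k o n).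
Local Notation Dmod := (@Dmod k o n).
Local Notation ahom := (ahom o n).

(** Index set of a basis at [v]: a generator [p] contributes the unique path from [blk p] to [v], if
    there is one. *)
Definition below N (blk : 'I_N -> nat) (v : nat) : {set 'I_N} :=
  [set p | (v < n)%N && reach o (blk p) v].

(* The D-module with underlying kQ-module the projective module on generators
   [p : 'I_N] at the vertices [blk p], and with [sum_gamma gamma gamma^*] given
   by [x]. *)
Definition std N (blk : 'I_N -> nat) (x : 'M[k]_N) : rep k :=
  @Rep k (fun v => #|below blk v|)
    (fun j => res (below blk j) (below blk j.+1) (if o j then 1%:M else x))
    (fun j => res (below blk j.+1) (below blk j) (if o j then x else 1%:M)).

Lemma mp_std N (blk : 'I_N -> nat) x u v : arr u v ->
  mp (std blk x) u v = res (below blk u) (below blk v) 1%:M.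
Proof.
by case/arrP=> j _ oj; rewrite ?mpF ?mpB /=; [rewrite oj|rewrite (negbTE oj)].
Qed.

Lemma mp_std_star N (blk : 'I_N -> nat) x u v : arr u v ->
  mp (std blk x) v u = res (below blk v) (below blk u) x.
Proof.
by case/arrP=> j _ oj; rewrite ?mpF ?mpB /=; [rewrite oj|rewrite (negbTE oj)].
Qed.

Lemma rdim_std0 N (blk : 'I_N -> nat) x v : (n <= v)%N -> rdim (std blk x) v = 0%N.
Proof.
move=> le /=; apply/eqP; rewrite cards_eq0; apply/eqP/setP=> p.
by rewrite !inE ltnNge le.
Qed.

Lemma belowS N (blk : 'I_N -> nat) u v : arr u v -> below blk u \subset below blk v.
Proof.
move=> a; apply/subsetP=> p; rewrite !inE (arr_ltr a) => /andP[_].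
exact: reach_arr a.
Qed.

Local Notation qrel := (qrel o).
Local Notation nrel := (nrel o).

Lemma qrel_below N N' (blk : 'I_N -> nat) (blk' : 'I_N' -> nat) (a : 'M[k]_(N, N')) v p q :
  msupp (qrel blk blk') a -> p \in below blk v -> q \notin below blk' v -> a p q = 0.
Proof.
move=> sa; rewrite !inE => /andP[-> h] nq; apply: sa; apply: contra nq => h'.
exact: reach_trans h' h.
Qed.

Lemma nrel_qrel N N' (blk : 'I_N -> nat) (blk' : 'I_N' -> nat) (a : 'M[k]_(N, N')) :
  msupp (nrel blk blk') a -> msupp (qrel blk blk') a.
Proof. by move=> sa p q h; apply: sa; rewrite /nrel (negbTE h). Qed.

(** A non-trivial path has a last arrow; so a radical homomorphism takes values in the images of the
    incoming arrows. *)
Lemma nrel_pred N N' (blk : 'I_N -> nat) (blk' : 'I_N' -> nat) v p q :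
  (forall q, blk' q < n)%N ->
  p \in below blk v -> nrel blk blk' p q -> exists2 u, arr u v & q \in below blk' u.
Proof.
move=> hb; rewrite !inE => /andP[ltv rp] /andP[rq npq].
have rqv := reach_trans rq rp.
have [|u a r] := reach_pred (hb q) ltv rqv.
  by apply: contra_neq npq => e; apply: (@reach_antisym o); rewrite // e.
by exists u => //; rewrite inE r (arr_ltl a).
Qed.

Lemma below_uniq N (blk : 'I_N -> nat) p u w v : arr u v -> arr w v ->
  p \in below blk u -> p \in below blk w -> u = w.
Proof.
by move=> au aw; rewrite !inE => /andP[_ h1] /andP[_ h2]; apply: reach_pred_uniq h1 h2; eassumption.
Qed.

(** The images of different incoming arrows share no basis vector, so a single summand contributes;
    [j] and [j'] are the same generator seen at [v] and at [u]. *)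
Lemma loop_entry N (blk : 'I_N -> nat) (y : forall v u, 'M[k]_(#|below blk v|, #|below blk u|))
    v u (i : 'I_#|below blk v|) (j : 'I_#|below blk v|) (j' : 'I_#|below blk u|) :
  arr u v -> enum_val j = enum_val j' ->
  (\sum_(w < n | arr w v) y v w *m res (below blk w) (below blk v) 1%:M) i j = y v u i j'.
Proof.
move=> auv ej; rewrite summxE (bigD1 (Ordinal (arr_ltl auv))) //= big1 => [|w /andP[awv nwu]].
  rewrite addr0 mxE (bigD1 j') //= resE mxE ej eqxx mulr1 big1 ?addr0 // => l /negbTE nl.
  by rewrite resE mxE ej (inj_eq enum_val_inj) nl mulr0.
rewrite mxE big1 // => l _; rewrite resE mxE; case: eqP => [e|_]; last by rewrite mulr0.
case/eqP: nwu; apply: val_inj => /=.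
apply: (@below_uniq _ blk (enum_val j) w u v) => //; first by rewrite -e enum_valP.
by rewrite ej enum_valP.
Qed.

Lemma loop_entry0 N (blk : 'I_N -> nat) (y : forall v u, 'M[k]_(#|below blk v|, #|below blk u|))
    v (i : 'I_#|below blk v|) (j : 'I_#|below blk v|) :
  (forall u, arr u v -> enum_val j \notin below blk u) ->
  (\sum_(w < n | arr w v) y v w *m res (below blk w) (below blk v) 1%:M) i j = 0.
Proof.
move=> h; rewrite summxE big1 // => w awv; rewrite mxE big1 // => l _.
rewrite resE mxE; case: eqP => [e|_]; last by rewrite mulr0.
by have := h _ awv; rewrite -e enum_valP.
Qed.

Section OneModule.
Variables (N : nat) (blk : 'I_N -> nat).
Hypothesis blk_lt : forall p, (blk p < n)%N.

Lemma mem_below p : p \in below blk (blk p).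
Proof. by rewrite inE blk_lt reach_refl. Qed.

Lemma loop_std x v : msupp (nrel blk blk) x ->
  loop (std blk x) v = res (below blk v) (below blk v) x.
Proof.
move=> sx; have -> : loop (std blk x) v =
    \sum_(w < n | arr w v) res (below blk v) (below blk w) x *m res (below blk w) (below blk v) 1%:M.
  by apply: eq_bigr => w a; rewrite (mp_std _ _ a) (mp_std_star _ _ a).
pose y v u := res (below blk v) (below blk u) x.
apply/matrixP=> i j; rewrite resE.
case: (boolP [exists u : 'I_n, arr u v && (enum_val j \in below blk u)]) => [|h].
  case/existsP=> u /andP[a ju].
  rewrite (@loop_entry _ _ y _ u _ _ (enum_rank_in ju (enum_val j))) //.
    by rewrite /y resE enum_rankK_in.
  by rewrite enum_rankK_in.
rewrite (@loop_entry0 _ _ y) => [|u a].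
  apply/esym/sx/negP => /(nrel_pred blk_lt (enum_valP i)) [u a ju].
  by case/existsP: h; exists (Ordinal (arr_ltl a)); rewrite /= a ju.
by apply: contra h => ju; apply/existsP; exists (Ordinal (arr_ltl a)); rewrite /= a ju.
Qed.

Lemma Dmod_std x : msupp (nrel blk blk) x -> Dmod (std blk x).
Proof.
move=> sx; split=> [v|u v a|u w v au aw nuw]; first exact: rdim_std0.
  by rewrite (mp_std _ _ a) (mp_std_star _ _ a) loop_std // res1_mul // belowS.
rewrite (mp_std _ _ au) (mp_std_star _ _ aw) res1_mul ?belowS //.
rewrite -(res0 k (below blk u) (below blk w)); apply/res_eqP => p q pu qw.
rewrite mxE; apply: (@qrel_below _ _ blk blk _ u p q) => //; first exact: nrel_qrel.
by apply/negP => qu; case/eqP: nuw; apply: (@below_uniq _ blk q u w v).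
Qed.

(** The rows compared are the images of the generators; the values on all other paths follow by
    transport along the arrows. *)
Lemma ahom_uniq (M : rep k) (x : 'M[k]_N) (f g : forall v, 'M[k]_(rdim (std blk x) v, rdim M v)) :
  ahom f -> ahom g ->
  (forall p, row p ((incl k (below blk (blk p)))^T *m f (blk p)) =
             row p ((incl k (below blk (blk p)))^T *m g (blk p))) ->
  forall v, f v = g v.
Proof.
move=> hf hg e v; rewrite -[f v]mul1mx -[g v]mul1mx -(inclK k (below blk v)) -!mulmxA.
apply: incl_eq => p; rewrite inE => /andP[ltv rp].
move: v ltv rp; apply: (reach_ind (blk_lt p)) => [|u v a rp IH]; first exact: e.
have pu : p \in below blk u by rewrite inE (arr_ltl a) rp.
have step (h : forall v, 'M[k]_(rdim (std blk x) v, rdim M v)) : ahom h ->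
    row p ((incl k (below blk v))^T *m h v) =
    row p ((incl k (below blk u))^T *m h u) *m mp M u v.
  move=> hh; rewrite -row_mul -mulmxA -hh // mp_std // /res mulmx1 !mulmxA.
  by rewrite -(mulmxA (_^T *m incl _ _)) row_incl_proj.
by rewrite !step // IH.
Qed.

Lemma ahom_res N' (blk' : 'I_N' -> nat) (x : 'M[k]_N) (x' : 'M[k]_N')
    (f : forall v, 'M[k]_(rdim (std blk x) v, rdim (std blk' x') v)) :
  ahom f -> exists2 a, msupp (qrel blk blk') a &
    forall v, f v = res (below blk v) (below blk' v) a.
Proof.
move=> hf; pose a : 'M[k]_(N, N') := \matrix_p row p
  ((incl k (below blk (blk p)))^T *m (f (blk p) : 'M_(_, #|below blk' (blk p)|))
     *m incl k (below blk' (blk p))).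
have sa : msupp (qrel blk blk') a.
  move=> p q npq; rewrite /a !mxE big1 // => j _; rewrite !mxE.
  case: eqP => [e|_]; last by rewrite mulr0.
  by case/negP: npq; have := enum_valP j; rewrite e inE => /andP[].
exists a => //; apply: (ahom_uniq (M := std blk' x') (g := fun v => res _ _ a) hf).
  move=> u v auv; rewrite !mp_std // res1_mul ?belowS // res_mul ?mulmx1 //.
  by move=> p q; apply: qrel_below.
move=> p; rewrite /res !mulmxA.
rewrite -(mulmxA (_ *m incl _ _)) row_incl_proj ?mem_below //.
by rewrite [RHS]row_mul /a rowK -row_mul -mulmxA inclK mulmx1.
Qed.

(* By the relations, [sum_gamma gamma gamma^*] is an endomorphism of the
   kQ-module, hence given by a matrix, and it determines every [gamma^*]. *)
Lemma star_std (y : forall v u, 'M[k]_(#|below blk v|, #|below blk u|)) :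
  (forall u v, arr u v -> res (below blk u) (below blk v) 1%:M *m y v u =
     \sum_(w < n | arr w u) y u w *m res (below blk w) (below blk u) 1%:M) ->
  (forall u w v, arr u v -> arr w v -> u != w ->
     res (below blk u) (below blk v) 1%:M *m y v w = 0) ->
  exists2 x, msupp (nrel blk blk) x &
    forall u v, arr u v -> y v u = res (below blk v) (below blk u) x.
Proof.
move=> r1 r2.
pose X v := \sum_(w < n | arr w v) y v w *m res (below blk w) (below blk v) 1%:M.
have hX : ahom (M := std blk 0) (N := std blk 0) X.
  (* After composition with the arrow from [u], relation (1) turns the term at [u] into [X u]
     followed by the arrow, and relation (2) kills the other terms. *)
  move=> u v auv; rewrite !mp_std // /X mulmx_sumr (bigD1 (Ordinal (arr_ltl auv))) //=.
  rewrite mulmxA r1 // [X in _ + X]big1 ?addr0 // => w /andP[awv nwu].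
  by rewrite mulmxA r2 ?mul0mx // eq_sym.
have [x sx xE] := ahom_res hX; exists x => [p q|u v auv].
  (* The values of [X] lie in the images of the incoming arrows, which contain no generator at the
     vertex itself; hence [x] has no entries between generators at the same vertex. *)
  rewrite /nrel negb_and => /orP[/sx //|]; rewrite negbK => /eqP e.
  have qb : q \in below blk (blk p) by rewrite e mem_below.
  have := xE (blk p) => /matrixP/(_ (enum_rank_in (mem_below p) p) (enum_rank_in qb q)).
  rewrite resE !enum_rankK_in ?mem_below // => <-; apply: loop_entry0 => u a.
  rewrite enum_rankK_in // inE (arr_ltl a) /=; apply/negP => /(reach_arrF a).
  by rewrite e eqxx.
apply/matrixP=> i j; rewrite resE.
have jv : enum_val j \in below blk v by apply: (subsetP (belowS blk auv)); apply: enum_valP.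
have := xE v => /matrixP/(_ i (enum_rank_in jv (enum_val j))).
by rewrite resE enum_rankK_in // => <-; rewrite /X (@loop_entry _ _ y v u i _ j) // enum_rankK_in.
Qed.

(** Transport of [g] away from [i], by [rF] upwards and by [rB] downwards; only on vertices reached
    from [i] does this follow paths of the quiver. *)
Lemma path_family (M : rep k) i (g : 'rV[k]_(rdim M i)) :
  exists2 w : forall v, 'rV[k]_(rdim M v), w i = g &
    forall u v, arr u v -> reach o i u -> w v = w u *m mp M u v.
Proof.
have fwd j (h : 'rV[k]_(rdim M j)) : exists2 w : forall v, 'rV[k]_(rdim M v), w j = h &
    forall v, (j <= v)%N -> w v.+1 = w v *m rF M v.
  (* At [j] the cast is the identity; the values before [j] are junk. *)
  pose W := fix W v : 'rV[k]_(rdim M v) := if v is v'.+1 return 'rV[k]_(rdim M v)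
    then if (v'.+1 <= j)%N then conform_mx 0 h else W v' *m rF M v' else conform_mx 0 h.
  exists W => [|v le]; last by rewrite /= ltnNge le.
  by case: j h @W => [|j] h /=; rewrite ?leqnn conform_mx_id.
have [w ew hw] : exists2 w : forall v, 'rV[k]_(rdim M v), w i = g &
    (forall v, (i <= v)%N -> w v.+1 = w v *m rF M v) /\
    (forall v, (v < i)%N -> w v = w v.+1 *m rB M v).
  elim: i g => [|i IH] g; first by have [w ew hw] := fwd _ g; exists w.
  have [w ew hw] := fwd _ g; have [w' ew' [_ hw']] := IH (g *m rB M i).
  exists (fun v => if (v <= i)%N then w' v else w v); first by rewrite ltnn.
  split=> v; first by move=> lt; rewrite [(v < i)%N]ltnNge (ltnW lt) (leqNgt v i) lt /= hw.
  move=> lev; have [->|nvi] := eqVneq v i; first by rewrite leqnn ltnn ew ew'.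
  have lt : (v < i)%N by rewrite ltn_neqAle nvi.
  by rewrite (ltnW lt) lt hw'.
exists w => // u v /arrP[] j lt oj; rewrite ?mpF ?mpB => /reachP[h1 h2].
  case: hw => hw _; apply: hw; rewrite leqNgt; apply/negP => lt'.
  by have := h2 j; rewrite leqnn lt' oj => /(_ isT).
case: hw => _ hw; apply: hw; rewrite ltnNge; apply/negP => le.
by move: oj; rewrite h1 // ltnSn le.
Qed.

(** Freeness of the projective module on its generators; it serves both to split extensions over kQ
    and to trivialise a module. *)
Lemma lift_ahom (M : rep k) (x : 'M[k]_N) (g : forall p, 'rV[k]_(rdim M (blk p))) :
  exists2 f : forall v, 'M[k]_(rdim (std blk x) v, rdim M v), ahom f &
    forall p, row p ((incl k (below blk (blk p)))^T *m f (blk p)) = g p.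
Proof.
have [w hw] : exists w : 'I_N -> forall v, 'rV[k]_(rdim M v), forall p,
    w p (blk p) = g p /\
    forall u v, arr u v -> reach o (blk p) u -> w p v = w p u *m mp M u v.
  have /fin_all_exists [w hw] p : exists w : forall v, 'rV[k]_(rdim M v),
    w (blk p) = g p /\
    forall u v, arr u v -> reach o (blk p) u -> w v = w u *m mp M u v.
    by have [w ? ?] := path_family (g p); exists w.
  by exists w.
exists (fun v => incl k (below blk v) *m \matrix_p w p v) => [u v auv|p].
  rewrite mp_std // /res mulmx1 !mulmxA inclS ?belowS // -mulmxA.
  apply: incl_eq => p; rewrite inE => /andP[_ r].
  by rewrite rowK row_mul rowK; apply: (proj2 (hw p)).
by rewrite mulmxA row_incl_proj ?mem_below // rowK; apply: (proj1 (hw p)).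
Qed.

End OneModule.
End Standard.

(** * Rigidity and extensions *)

Section Translation.
Variables (k : fieldType) (o : nat -> bool) (n : nat).
Local Notation arr := (arr o n).
Local Notation mp := (@mp k).
Local Notation loop := (@loop k o n).
Local Notation Dmod := (@Dmod k o n).
Local Notation ahom := (ahom o n).
Local Notation below := (below o n).
Local Notation std := (std o n).
Local Notation qrel := (qrel o).
Local Notation nrel := (nrel o).

Section Standard.
Variables (N : nat) (blk : 'I_N -> nat).
Hypothesis blk_lt : forall p, (blk p < n)%N.

Lemma nrel_qrel_trans N' N'' (blk' : 'I_N' -> nat) (blk'' : 'I_N'' -> nat) p q r :
  nrel blk blk' p q -> qrel blk' blk'' q r -> nrel blk blk'' p r.
Proof.
move=> /andP[h1 npq] h2; rewrite /nrel /qrel (reach_trans h2 h1) /=.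
by apply: contra_neq npq => e; apply: (@reach_antisym o) h1; rewrite e.
Qed.

Lemma qrel_nrel_trans N' N'' (blk' : 'I_N' -> nat) (blk'' : 'I_N'' -> nat) p q r :
  qrel blk blk' p q -> nrel blk' blk'' q r -> nrel blk blk'' p r.
Proof.
move=> h1 /andP[h2 nqr]; rewrite /nrel /qrel (reach_trans h2 h1) /=.
by apply: contra_neq nqr => e; apply: (@reach_antisym o) h2; rewrite -e.
Qed.

(** A non-zero entry of [x] leads below some incoming arrow of [v]; by uniqueness of last arrows,
    only the arrow from [u] is compatible with a final index below [u]. *)
Lemma star_comp N' (blk' : 'I_N' -> nat) x (a : 'M[k]_(N, N')) u v : arr u v ->
  msupp (qrel blk blk') a -> msupp (nrel blk blk) x ->
  res (below blk v) (below blk u) x *m res (below blk u) (below blk' u) a =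
  res (below blk v) (below blk' u) (x *m a).
Proof.
move=> auv sa sx; apply: res_mul_cond => p q r pv nqu ru.
case: (boolP (nrel blk blk p q)) => [npq|/sx->]; last by rewrite mul0r.
have [w awv qw] := nrel_pred blk_lt pv npq.
rewrite (qrel_below sa qw) ?mulr0 //; apply: contra nqu => rw.
by rewrite (below_uniq auv awv ru rw).
Qed.

Lemma comp_star N' (blk' : 'I_N' -> nat) x' (a : 'M[k]_(N, N')) u v :
  msupp (qrel blk blk') a ->
  res (below blk v) (below blk' v) a *m res (below blk' v) (below blk' u) x' =
  res (below blk v) (below blk' u) (a *m x').
Proof. by move=> sa; apply: res_mul => p q; apply: qrel_below. Qed.

Lemma is_hom_res N' (blk' : 'I_N' -> nat) x x' (a : 'M[k]_(N, N')) :
  msupp (qrel blk blk') a -> msupp (nrel blk blk) x -> x *m a = a *m x' ->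
  @is_hom k (std blk x) (std blk' x') (fun v => res (below blk v) (below blk' v) a).
Proof.
move=> sa sx e; apply: (@is_homP k o n) => [v|v|u v auv|u v auv]; try exact: rdim_std0.
  rewrite !(mp_std _ _ auv) res1_mul ?belowS // res_mul ?mulmx1 //.
  by move=> p q; apply: qrel_below.
by rewrite !(mp_std_star _ _ auv) star_comp // comp_star // e.
Qed.

(** The star maps see exactly the entries along non-trivial paths; the remaining entries of both
    products vanish because n is an ideal. *)
Lemma hom_commute N' (blk' : 'I_N' -> nat) x x' (a : 'M[k]_(N, N')) :
  (forall q, (blk' q < n)%N) ->
  msupp (qrel blk blk') a -> msupp (nrel blk blk) x -> msupp (nrel blk' blk') x' ->
  @is_hom k (std blk x) (std blk' x') (fun v => res (below blk v) (below blk' v) a) ->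
  x *m a = a *m x'.
Proof.
move=> blk'_lt sa sx sx' hh; apply/matrixP=> p r.
case: (boolP (nrel blk blk' p r)) => [npr|nn].
  have [u auv ru] := nrel_pred blk'_lt (mem_below o blk_lt p) npr.
  have := is_hom_star hh auv; rewrite !(mp_std_star _ _ auv) star_comp // comp_star //.
  by move=> /res_eqP; apply=> //; apply: mem_below.
transitivity (0 : k); [|symmetry]; move: nn.
  by apply: (msuppM (T := nrel blk blk') _ sx sa) => i j l; apply: nrel_qrel_trans.
by apply: (msuppM (T := nrel blk blk') _ sa sx') => i j l; apply: qrel_nrel_trans.
Qed.

(* [Ext^1] is the cokernel of [a |-> a x - x a]: an extension splits over kQ,
   and its star maps differ from those of the direct sum by an element of the
   target of this map. *)
Lemma rigid_exceptional (x : 'M[k]_N) : msupp (nrel blk blk) x ->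
  rigid (qrel blk blk) (nrel blk blk) x -> exceptional n o (std blk x).
Proof.
move=> sx rx E iota pr /DmodP dE hiota hpr ex.
have [dE0 dE1 dE2] := dE; have [d0 d1 d2] := Dmod_std blk_lt sx.
have free v : row_free (iota v) by case: (ex v).
have full v : row_full (pr v) by case: (ex v).
have ker v : (kermx (pr v) <= iota v)%MS by case: (ex v) => _ _ /andP[].
have iota_pr v : iota v *m pr v = 0.
  by apply/sub_kermxP; case: (ex v) => _ _ /andP[].
have aiota := is_hom_ahom (o := o) (n := n) hiota.
have apr := is_hom_ahom (o := o) (n := n) hpr.
(* A section over kQ, obtained by lifting the generators through [pr]. *)
have [s0 hs0 s0g] := lift_ahom o blk_lt x (fun p =>
  row p ((incl k (below blk (blk p)))^T *m pinvmx (pr (blk p)))).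
have s0pr v : s0 v *m pr v = 1%:M.
  apply: (ahom_uniq (M := std blk x) (f := fun v => s0 v *m pr v) (g := fun v => 1%:M) blk_lt).
  - by move=> u w a; rewrite mulmxA hs0 // -mulmxA apr // mulmxA.
  - by move=> u w a; rewrite mulmx1 mul1mx.
  - by move=> p; rewrite mulmxA row_mul s0g -row_mul -mulmxA mulVpmx ?full.
(* The defect of [s0] on star maps dies under [pr], so it factors through [iota] as [Y]. Since both
   modules satisfy the relations, [Y] satisfies those of [star_std]. *)
pose delta v u := mp (std blk x) v u *m s0 u - s0 v *m mp E v u.
pose Y v u : 'M[k]_(#|below blk v|, #|below blk u|) := delta v u *m pinvmx (iota u).
have YE u v : arr u v -> Y v u *m iota u = delta v u.
  move=> a; rewrite /Y mulmxKpV //; apply: submx_trans (ker u); apply/sub_kermxP.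
  rewrite mulmxBl -2!mulmxA s0pr mulmx1 (is_hom_star hpr a) mulmxA s0pr mul1mx.
  by rewrite subrr.
have [u v a|u w v au aw nuw|y sy yE] := star_std blk_lt (y := Y).
- apply: (row_free_inj (free u)); rewrite -mulmxA YE // mulmx_suml.
  rewrite -(mp_std _ x a) mulmxBr !mulmxA d1 // hs0 // -[X in _ - X]mulmxA dE1 //.
  rewrite /loop mulmx_suml mulmx_sumr -sumrB; apply: eq_bigr => w awu.
  rewrite -(mp_std _ x awu) -[RHS]mulmxA aiota // [RHS]mulmxA YE // mulmxBl.
  by rewrite -!mulmxA hs0.
- apply: (row_free_inj (free w)); rewrite mul0mx -mulmxA YE //.
  rewrite -(mp_std _ x au) mulmxBr !mulmxA (d2 _ _ _ au aw nuw) hs0 // -mulmxA.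
  by rewrite (dE2 _ _ _ au aw nuw) mulmx0 mul0mx subrr.
have [a sa ea] := rx y sy.
pose A v := res (below blk v) (below blk v) a.
exists (fun v => s0 v + A v *m iota v); split; last first.
  by move=> v; rewrite mulmxDl s0pr -mulmxA iota_pr mulmx0 addr0.
apply: (@is_homP k o n) => // u v auv.
  rewrite mulmxDr mulmxDl hs0 // -(mulmxA (A u)) -aiota //.
  rewrite (mulmxA (mp _ u v)) (mulmxA (A u)); congr (_ + _ *m _).
  rewrite !(mp_std _ _ auv) /A res1_mul ?belowS // res_mul ?mulmx1 //.
  by move=> p q; apply: qrel_below.
apply/eqP; rewrite -subr_eq0 mulmxDr mulmxDl -(mulmxA (A v)) -(is_hom_star hiota auv).
rewrite opprD addrACA -/(delta v u) -YE // (mulmxA (mp _ v u)) (mulmxA (A v)) -mulmxBl -mulmxDl.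
rewrite yE // !(mp_std_star _ _ auv) /A star_comp // comp_star // -resB -resD -ea.
by rewrite addrA subrK subrr res0 mul0mx.
Qed.

End Standard.

Lemma split_exact m1 m2 m3 (i : 'M[k]_(m1, m2)) (p : 'M[k]_(m2, m3)) r j :
  i *m p = 0 -> i *m r = 1%:M -> j *m p = 1%:M -> r *m i + p *m j = 1%:M ->
  [/\ row_free i, row_full p & (i == kermx p)%MS].
Proof.
move=> ip ir jp e; split; [by apply/row_freeP; exists r|by apply/row_fullP; exists j|].
apply/andP; split; first exact/sub_kermxP.
by rewrite -[kermx p]mulmx1 -e mulmxDr !mulmxA mulmx_ker mul0mx addr0 submxMl.
Qed.

(** Each [y] in n defines a self-extension with matrix [block_mx x 0 y x]. A section of it is a row
    [(a, 1)], and its compatibility with the star maps says that [- a] solves the equation for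
    [y]. *)
Lemma exceptional_rigid N (blk : 'I_N -> nat) (M : rep k) x :
  (forall p, (blk p < n)%N) -> msupp (nrel blk blk) x ->
  isomorphic M (std blk x) -> exceptional n o M ->
  rigid (qrel blk blk) (nrel blk blk) x.
Proof.
move=> blk_lt sx [f [g [hf [hg fg]]]] exM y sy.
pose blk2 (p : 'I_(N + N)) := match split p with inl p' => blk p' | inr p' => blk p' end.
have blk2_lt p : (blk2 p < n)%N by rewrite /blk2; case: split.
have blk2l p : blk2 (lshift N p) = blk p by rewrite /blk2 (unsplitK (inl _ : 'I_N + 'I_N)).
have blk2r p : blk2 (rshift N p) = blk p by rewrite /blk2 (unsplitK (inr _ : 'I_N + 'I_N)).
have s1 : msupp (qrel blk blk) (1%:M : 'M[k]_N).
  by move=> p q; rewrite mxE; case: eqP => // ->; rewrite /qrel reach_refl.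
have srow (R : nat -> nat -> bool) (a b : 'M[k]_N) :
    msupp (fun p q => R (blk p) (blk q)) a -> msupp (fun p q => R (blk p) (blk q)) b ->
    msupp (fun p q => R (blk p) (blk2 q)) (row_mx a b).
  move=> ha hb p q; case: (split_ordP q) => q' ->; rewrite ?blk2l ?blk2r ?row_mxEl ?row_mxEr.
    exact: ha.
  exact: hb.
have scol (R : nat -> nat -> bool) m (B : 'I_m -> nat) (a b : 'M[k]_(N, m)) :
    msupp (fun p q => R (blk p) (B q)) a -> msupp (fun p q => R (blk p) (B q)) b ->
    msupp (fun p q => R (blk2 p) (B q)) (col_mx a b).
  move=> ha hb p q; case: (split_ordP p) => p' ->; rewrite ?blk2l ?blk2r ?col_mxEu ?col_mxEd.
    exact: ha.
  exact: hb.
pose Rq u v := reach o v u; pose Rn u v := reach o v u && (u != v).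
pose X : 'M[k]_(N + N) := block_mx x 0 y x.
have sX : msupp (nrel blk2 blk2) X.
  by apply: (scol Rn); apply: (srow Rn) => //; exact: msupp0.
have si : msupp (qrel blk blk2) (row_mx (1%:M : 'M[k]_N) 0) by apply: (srow Rq) => //; exact: msupp0.
have sj : msupp (qrel blk blk2) (row_mx 0 (1%:M : 'M[k]_N)) by apply: (srow Rq) => //; exact: msupp0.
have sp : msupp (qrel blk2 blk) (col_mx 0 (1%:M : 'M[k]_N)) by apply: (scol Rq) => //; exact: msupp0.
have sr : msupp (qrel blk2 blk) (col_mx (1%:M : 'M[k]_N) 0) by apply: (scol Rq) => //; exact: msupp0.
pose ii v := res (below blk v) (below blk2 v) (row_mx (1%:M : 'M[k]_N) 0).
pose pp v := res (below blk2 v) (below blk v) (col_mx 0 (1%:M : 'M[k]_N)).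
have hi : @is_hom k (std blk x) (std blk2 X) ii.
  apply: is_hom_res => //; rewrite mul_mx_row mulmx1 mulmx0 mul_row_block.
  by rewrite !mul1mx !mul0mx !addr0.
have hp : @is_hom k (std blk2 X) (std blk x) pp.
  apply: is_hom_res => //; rewrite [RHS]mul_col_mx mul1mx mul0mx mul_block_col.
  by rewrite !mulmx1 !mulmx0 !add0r.
have := exM (std blk2 X) (fun v => f v *m ii v) (fun v => pp v *m g v).
case.
- exact/DmodP/Dmod_std.
- exact: (is_hom_comp hf hi).
- exact: (is_hom_comp hp hg).
- move=> v; have [fgv gfv] := fg v.
  have mulq := @qrel_below k o n.
  have ip : ii v *m pp v = 0.
    rewrite /ii /pp res_mul; last by move=> p q; apply: mulq.
    by rewrite mul_row_col mulmx0 mul0mx addr0 res0.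
  have ir : ii v *m res (below blk2 v) (below blk v) (col_mx (1%:M : 'M[k]_N) 0) = 1%:M.
    rewrite /ii res_mul; last by move=> p q; apply: mulq.
    by rewrite mul_row_col mulmx1 mul0mx addr0 res1.
  have jp : res (below blk v) (below blk2 v) (row_mx 0 (1%:M : 'M[k]_N)) *m pp v = 1%:M.
    rewrite /pp res_mul; last by move=> p q; apply: mulq.
    by rewrite mul_row_col mulmx1 mul0mx add0r res1.
  have e : res (below blk2 v) (below blk v) (col_mx (1%:M : 'M[k]_N) 0) *m ii v
      + pp v *m res (below blk v) (below blk2 v) (row_mx 0 (1%:M : 'M[k]_N)) = 1%:M.
    rewrite /ii /pp !res_mul; try by move=> p q; apply: mulq.
    rewrite -resD !mul_col_row !(mul1mx, mul0mx, mulmx0) add_block_mx !addr0 !add0r.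
    by rewrite -scalar_mx_block res1.
  apply: (@split_exact _ _ _ _ _
    (res (below blk2 v) (below blk v) (col_mx (1%:M : 'M[k]_N) 0) *m g v)
    (f v *m res (below blk v) (below blk2 v) (row_mx 0 (1%:M : 'M[k]_N)))).
  + by rewrite -mulmxA (mulmxA (ii v)) ip mul0mx mulmx0.
  + by rewrite -mulmxA (mulmxA (ii v)) ir mul1mx.
  + by rewrite -mulmxA (mulmxA _ (pp v)) jp mul1mx.
  + rewrite -mulmxA (mulmxA (g v)) gfv mul1mx -(mulmxA (pp v)) (mulmxA (g v)) gfv mul1mx.
    exact: e.
move=> s [hs sp1].
have hgs := is_hom_comp hg hs.
have [a sa aE] := ahom_res blk_lt (is_hom_ahom (o := o) (n := n) hgs).
have ha : @is_hom k (std blk x) (std blk2 X) (fun v => res (below blk v) (below blk2 v) a).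
  by move=> j; rewrite -!aE; apply: hgs.
have := hom_commute blk_lt blk2_lt sa sx sX ha.
have sa2 : msupp (qrel blk blk) (rsubmx a).
  move=> p q h; rewrite mxE; apply: sa; rewrite /qrel blk2r; exact: h.
have sa1 : msupp (qrel blk blk) (lsubmx a).
  move=> p q h; rewrite mxE; apply: sa; rewrite /qrel blk2l; exact: h.
(* Up to the isomorphism with [M], the right half of [a] is the section followed by the
   projection. *)
have a2 : rsubmx a = 1%:M.
  apply/matrixP=> p q.
  case: (boolP (qrel blk blk p q)) => [rpq|nr]; last by rewrite sa2 // s1.
  have : g (blk p) *m s (blk p) *m pp (blk p) = 1%:M.
    move: (pp (blk p)) (sp1 (blk p)) => P eP; have [_ gf] := fg (blk p).
    by rewrite -[P]mulmx1 -gf -mulmxA (mulmxA P) (mulmxA (s _)) eP mul1mx gf.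
  rewrite aE /pp res_mul; last by move=> p' q'; apply: qrel_below.
  rewrite -{1}(hsubmxK a) mul_row_col mulmx0 mulmx1 add0r -(res1 k (below blk (blk p))).
  by move/res_eqP; apply; rewrite ?(mem_below o blk_lt) // inE blk_lt.
rewrite -(hsubmxK a) a2 mul_mx_row mul_row_block mulmx1 !mul1mx mulmx0 add0r.
case/eq_row_mx => e _; exists (- lsubmx a); first exact: msuppN.
by rewrite mulNmx mulmxN opprK e addrA addNr add0r.
Qed.

End Translation.

(** * Trivialising the underlying projective module *)

Section Trivialisation.
Variables (k : fieldType) (o : nat -> bool) (n : nat).
Local Notation arr := (arr o n).
Local Notation mp := (@mp k).
Local Notation loop := (@loop k o n).
Local Notation Dmod := (@Dmod k o n).
Local Notation ahom := (ahom o n).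
Local Notation below := (below o n).
Local Notation std := (std o n).
Local Notation qrel := (qrel o).
Local Notation nrel := (nrel o).

Variant incoming_spec v : Prop :=
  | Incoming0 of (forall w, ~~ arr w v)
  | Incoming1 u of arr u v & (forall w, arr w v -> w = u)
  | Incoming2 j of v = j.+1 & (j.+2 < n)%N & o j & ~~ o j.+1.

(** On a line at most two arrows enter a vertex, and two do so only where the disjointness clause of
    [Delta_filtered] applies. *)
Lemma incomingP v : incoming_spec v.
Proof.
case: (boolP (arr v.+1 v)) => [a|na].
  case: v a => [|v] a.
    apply: (Incoming1 a) => w /and3P[_ _ /orP[]/andP[/eqP e oe]] //.
  case: (boolP (o v)) => ov.
    case/and3P: a => lt _ /orP[]/andP[/eqP e ov'].
      by move/eqP: e; rewrite ltn_eqF // ltnS leqnSn.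
    exact: (Incoming2 (j := v)).
  apply: (Incoming1 a) => w /and3P[_ _ /orP[]/andP[/eqP e oe]] //.
  by case: e oe ov => ->; move=> ->.
case: (boolP (arr v.-1 v)) => [a|na'].
  apply: (Incoming1 a) => w aw; case/arrP: aw na => [j //|j lt oj].
  by rewrite (introT (arrP _ _ _ _) (ArrB lt oj)).
apply: Incoming0 => w; apply/negP => aw; case/arrP: aw na na' => j lt oj.
  by move=> _; rewrite (introT (arrP _ _ _ _) (ArrF lt oj)).
by rewrite (introT (arrP _ _ _ _) (ArrB lt oj)).
Qed.

(** Injectivity and disjointness together say that the incoming images form a direct sum. *)
Lemma rank_incoming (M : rep k) v : Delta_filtered n o M ->
  \rank (\sum_(u < n | arr u v) <<mp M u v>>)%MS = (\sum_(u < n | arr u v) rdim M u)%N.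
Proof.
case=> inj disj.
have rk u w : arr u w -> \rank (mp M u w) = rdim M u.
  by case/arrP=> j lt oj; apply/eqP; have := inj j lt; rewrite ?mpF ?mpB ?oj ?(negbTE oj).
case: (incomingP v) => [h|u a h|j e lt oj oj'].
- by rewrite !big_pred0 ?mxrank0 // => w; apply/negbTE/h.
- have h' : (fun w : 'I_n => arr w v) =1 pred1 (Ordinal (arr_ltl a)).
    by move=> w; apply/idP/eqP => [/h ew|->//]; apply: val_inj.
  by rewrite !(big_pred1 _ h') mxrank_gen /= rk.
subst v; have a1 : arr j j.+1 by apply/arrP/ArrF/oj/ltnW.
have a2 : arr j.+2 j.+1 by apply/arrP/ArrB.
rewrite (bigD1 (Ordinal (arr_ltl a1))) //= [RHS](bigD1 (Ordinal (arr_ltl a1))) //=.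
have h' : (fun w : 'I_n => arr w j.+1 && (w != Ordinal (arr_ltl a1))) =1 pred1 (Ordinal (arr_ltl a2)).
  move=> w /=; apply/idP/eqP => [/andP[/and3P[_ _ /orP[]/andP[/eqP ew ow]] nw]|->].
  - by case/eqP: nw; apply: val_inj; case: ew.
  - exact: val_inj.
  - by rewrite /= a2 -val_eqE /= gtn_eqF // ltnS leqnSn.
rewrite !(big_pred1 _ h') /= mxrank_disjoint_sum ?mxrank_gen ?rk //.
apply/eqP; rewrite -mxrank_eq0 mpF mpB.
have /eqmxP : (<<rF M j>> :&: <<rB M j.+1>> :=: rF M j :&: rB M j.+1)%MS.
  by apply: cap_eqmx; apply: genmxE.
by move/eqmxP => ->; rewrite disj.
Qed.

Section Blocks.
Variables (N : nat) (blk : 'I_N -> nat).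
Hypothesis blk_lt : forall p, (blk p < n)%N.

(** A path to [v] is trivial or factors through exactly one incoming arrow. *)
Lemma card_below_incoming v : (v < n)%N ->
  #|below blk v| = (#|[set p | blk p == v]| + \sum_(u < n | arr u v) #|below blk u|)%N.
Proof.
move=> ltv.
have cardE (A : {set 'I_N}) : #|A| = (\sum_p (p \in A))%N by rewrite -sum1_card big_mkcond.
rewrite !cardE (eq_bigr (fun u : 'I_n => \sum_p (p \in below blk u))%N) => [|u _]; last exact: cardE.
rewrite exchange_big -big_split /=; apply: eq_bigr => p _.
rewrite !inE ltv /=; have [e|ne] := eqVneq (blk p) v.
  rewrite e reach_refl big1 // => u a; rewrite inE (arr_ltl a) /= e.
  by case: (boolP (reach o v u)) => // /(reach_arrF a); rewrite eqxx.
case: (boolP (reach o (blk p) v)) => [r|nr].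
  have [u a ru] := reach_pred (blk_lt p) ltv r ne.
  rewrite (bigD1 (Ordinal (arr_ltl a))) //= inE (arr_ltl a) ru big1 // => w /andP[aw nw].
  rewrite inE (arr_ltl aw) /=; case: (boolP (reach o (blk p) w)) => // rw.
  by case/eqP: nw; apply: val_inj; apply: reach_pred_uniq rw ru; eassumption.
rewrite big1 // => u a; rewrite inE (arr_ltl a) /=.
by case: (boolP (reach o _ u)) => // /(reach_arr a); rewrite (negbTE nr).
Qed.

(** Bases of complements of the incoming images generate [M] over kQ, by induction along the arrows.
    The resulting surjection from the projective module is bijective by dimension, and the
    transported star maps are given by a matrix by [star_std]. *)
Lemma Delta_trivial (M : rep k) : is_Dmod n o M -> Delta_filtered n o M ->
  (forall v, (v < n)%N -> rdim M v = #|below blk v|) ->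
  exists2 x, msupp (nrel blk blk) x & isomorphic M (std blk x).
Proof.
move=> /DmodP [d0 d1 d2] filt dimM.
pose W v := (\sum_(u < n | arr u v) <<mp M u v>>)%MS.
pose B v := [set p | blk p == v].
have rkWC v : (v < n)%N -> \rank (W v)^C = #|B v|.
  move=> ltv; rewrite mxrank_compl rank_incoming // dimM // card_below_incoming //.
  by rewrite [X in (_ - X)%N](eq_bigr (fun u : 'I_n => #|below blk u|)) ?addnK // => u _; rewrite dimM.
(* Generators at [v] are matched by position with a basis of the complement; by the rank count the
   default 0 is not reached for [p] in [B v]. *)
pose G v (p : 'I_N) : 'rV[k]_(rdim M v) :=
  if insub (index p (enum (B v))) is Some i then row i (row_base (W v)^C%MS) else 0.
have [f hf fE] := lift_ahom o blk_lt 0 (fun p => G (blk p) p).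
have full v : row_full (f v).
  case: (ltnP v n) => [|le]; last by rewrite /row_full eqn_leq rank_leq_col (leq_trans _ (leq0n _)) // d0.
  move: {2}(depth o n v) (leqnn (depth o n v)) => m; elim: m v => [|m IH] v.
    move=> lev ltv; move: lev; rewrite leqn0 cards_eq0 => /eqP/setP/(_ (Ordinal ltv)).
    by rewrite !inE reach_refl.
  move=> lev ltv; rewrite -sub1mx.
  have /submx_trans -> // : (1%:M <= W v + (W v)^C)%MS by rewrite sub1mx addsmx_compl_full.
  rewrite addsmx_sub; apply/andP; split.
    apply/sumsmx_subP => u a; rewrite genmxE.
    have fu : row_full (f u).
      by apply: IH (arr_ltl a); rewrite -ltnS; apply: leq_trans lev; apply: arr_depth.
    by rewrite -[mp M u v]mul1mx -(mulVpmx fu) -mulmxA -hf // mulmxA submxMl.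
  rewrite -(eq_row_base (W v)^C%MS); apply/row_subP => i.
  have lti : (i < #|B v|)%N by rewrite -rkWC // ltn_ord.
  pose p := enum_val (Ordinal lti).
  have ep : index p (enum (B v)) = i.
    by rewrite /p (enum_val_nth (enum_val (Ordinal lti))) index_uniq ?enum_uniq // -cardE.
  have -> : row i (row_base (W v)^C%MS) = G v p by rewrite /G ep valK.
  have : p \in B v by apply: enum_valP.
  rewrite inE; move: (p) => p' /eqP <-.
  by rewrite -fE row_mul submxMl.
have free v : row_free (f v).
  have /eqP rk := full v; rewrite /row_free rk.
  case: (ltnP v n) => lt; first by rewrite dimM.
  by rewrite d0 // eq_sym; apply/eqP/(@rdim_std0 k o n _ blk 0).
have [fi [ffi fif]] : exists fi : forall v, 'M[k]_(rdim M v, rdim (std blk 0) v),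
    (forall v, f v *m fi v = 1%:M) /\ (forall v, fi v *m f v = 1%:M).
  by exists (fun v => pinvmx (f v)); split=> v; [apply: mulmxVp|apply: mulVpmx].
pose Y v u : 'M[k]_(#|below blk v|, #|below blk u|) := f v *m mp M v u *m fi u.
have res_f u v : arr u v -> res (below blk u) (below blk v) 1%:M *m f v = f u *m mp M u v.
  by move=> a; rewrite -(mp_std blk 0 a) hf.
have fi_res u v : arr u v -> fi u *m res (below blk u) (below blk v) 1%:M = mp M u v *m fi v.
  move=> a; rewrite -[LHS]mulmx1 -(ffi v) mulmxA -(mulmxA (fi u)) res_f //.
  by rewrite mulmxA fif mul1mx.
have [u v a|u w v au aw nuw|x sx xE] := star_std blk_lt (y := Y).
- rewrite /Y !mulmxA res_f // -(mulmxA (f u)) d1 // /loop mulmx_sumr mulmx_suml.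
  by apply: eq_bigr => w aw; rewrite -[RHS]mulmxA fi_res // !mulmxA.
- by rewrite /Y !mulmxA res_f // -(mulmxA (f u)) (d2 _ _ _ au aw nuw) mulmx0 mul0mx.
exists x => //; apply: isomorphic_sym.
apply: (@isomorphicP _ (std blk x) M f fi) => //.
apply: (@is_homP k o n) => [v||u v a|u v a] //; first exact: rdim_std0.
  by rewrite (mp_std _ _ a) res_f.
by rewrite (mp_std_star _ _ a) -(xE _ _ a) /Y -(mulmxA _ (fi u)) fif mulmx1.
Qed.

Lemma Delta_filtered_std (x : 'M[k]_N) : Delta_filtered n o (std blk x).
Proof.
have split_res u v : arr u v ->
    res (below blk u) (below blk v) 1%:M *m res (below blk v) (below blk u) 1%:M = 1%:M :> 'M[k]_#|below blk u|.
  by move=> a; rewrite res1_mul ?belowS // res1.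
split=> [j lt|i lt oi oi'].
  case: (boolP (o j)) => oj; rewrite /= ?oj ?(negbTE oj); apply/row_freeP.
    by eexists; apply: split_res; apply/arrP/ArrF.
  by eexists; apply: split_res; apply/arrP/ArrB.
have a1 : arr i i.+1 by apply/arrP/ArrF/oi/ltnW.
have a2 : arr i.+2 i.+1 by apply/arrP/ArrB.
rewrite /= oi (negbTE oi'); apply/eqP; rewrite mxrank_eq0.
set U := res _ _ _; set V := res _ _ _.
have /submxP [A eA] := capmxSl U V; have /submxP [B eB] := capmxSr U V.
have A0 : A = 0.
  rewrite -[A]mulmx1 -(split_res _ _ a1) mulmxA -eA eB -mulmxA /V res1_mul ?belowS //.
  rewrite (_ : res _ _ _ = 0) ?mulmx0 // -(res0 k (below blk i.+2) (below blk i)).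
  apply/res_eqP => p q pi qi; rewrite !mxE; case: eqP => // e; move: qi; rewrite -e => qi.
  have := below_uniq a2 a1 pi qi => /eqP; by rewrite gtn_eqF // ltnS leqnSn.
by rewrite eA A0 mul0mx.
Qed.

(** The rows of [g] below [v] have no entries in other columns, so the corresponding block of
    [invmx g], whatever its support, is a one-sided inverse. *)
Lemma res_unit (g : 'M[k]_N) v : msupp (qrel blk blk) g -> g \in unitmx ->
  res (below blk v) (below blk v) g \in unitmx.
Proof.
move=> sg ug; rewrite -row_free_unit; apply/row_freeP.
exists (incl k (below blk v) *m invmx g *m (incl k (below blk v))^T).
rewrite /res !mulmxA incl_supp; last by move=> p q; apply: qrel_below.
by rewrite -(mulmxA _ g) mulmxV // mulmx1 inclK.
Qed.

Lemma std_isomorphic (x y g : 'M[k]_N) : msupp (qrel blk blk) g -> g \in unitmx ->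
  msupp (nrel blk blk) x -> x *m g = g *m y -> isomorphic (std blk x) (std blk y).
Proof.
move=> sg ug sx e.
apply: (@isomorphicP _ (std blk x) (std blk y) _
  (fun v => invmx (res (below blk v) (below blk v) g)) (is_hom_res blk_lt sg sx e)) => v;
  [apply: mulmxV|apply: mulVmx]; exact: res_unit.
Qed.

End Blocks.
End Trivialisation.

(** * Dimension counts and conclusion *)

Lemma sum_block (d : nat -> nat) m (F : nat -> nat) :
  (\sum_(p < totdim d m) F (block p) = \sum_(i < m) d i * F i)%N.
Proof.
elim: m => [|m IH]; first by rewrite !big_ord0.
rewrite big_ord_recr /= -IH big_split_ord /=; congr (_ + _)%N.
  by apply: eq_bigr => p _; rewrite (unsplitK (inl _ : 'I_(totdim d m) + 'I_(d m))).
rewrite -[d m in RHS]card_ord -sum_nat_const; apply: eq_bigr => p _.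
by rewrite (unsplitK (inr _ : 'I_(totdim d m) + 'I_(d m))).
Qed.

Lemma card_below_block (o : nat -> bool) n (d : nat -> nat) v : (v < n)%N ->
  #|below o n (@block d n) v| = (\sum_(i < n) d i * reach o i v)%N.
Proof.
move=> ltv; rewrite -(sum_block d n (fun i => reach o i v)) -sum1_card big_mkcond /=.
by apply: eq_bigr => p _; rewrite inE ltv.
Qed.

Lemma npathsE o i v : npaths o i v = reach o i v.
Proof. by rewrite /npaths /reach; case: ifP. Qed.

Theorem mainTheorem1 (k : closedFieldType) (hk : [pchar k]%R =i pred0)
    (n : nat) (hn : (0 < n)%N) (o : nat -> bool)
    (d : 'I_n -> nat) (hd : exists i, d i <> 0%N) :
  (exists M : rep k,
     [/\ is_Dmod n o M, Delta_filtered n o M, Delta_dim n o M d & exceptional n o M]) /\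
  (forall M N : rep k,
     is_Dmod n o M -> Delta_filtered n o M -> Delta_dim n o M d -> exceptional n o M ->
     is_Dmod n o N -> Delta_filtered n o N -> Delta_dim n o N d -> exceptional n o N ->
     isomorphic M N).
Proof.
(* [d'] extends [d] by zero to all natural numbers, as [totdim] and [block] require. *)
pose d' i := oapp d 0%N (insub i).
have blk_lt := @block_lt d' n.
have dimE v : (v < n)%N ->
    (\sum_(i < n) d i * npaths o i v)%N = #|below o n (@block d' n) v|.
  move=> ltv; rewrite card_below_block //; apply: eq_bigr => i _.
  by rewrite /d' valK npathsE.
split.
  have [x sx rx] := exists_rigid k o d' n.
  exists (std o n (@block d' n) x); split.
  - exact/DmodP/Dmod_std.
  - exact: Delta_filtered_std.
  - by move=> v; rewrite dimE.
  - exact: rigid_exceptional.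
have triv (M : rep k) : is_Dmod n o M -> Delta_filtered n o M -> Delta_dim n o M d ->
    exceptional n o M -> exists x, [/\ msupp (nrel o (@block d' n) (@block d' n)) x,
      rigid (qrel o (@block d' n) (@block d' n)) (nrel o (@block d' n) (@block d' n)) x
      & isomorphic M (std o n (@block d' n) x)].
  move=> dM fM dimM exM; have [|x sx iso] := Delta_trivial blk_lt dM fM.
    by move=> v ltv; rewrite -dimE // -(dimM (Ordinal ltv)).
  by exists x; split=> //; apply: exceptional_rigid iso exM.
move=> M N dM fM dimM exM dN fN dimN exN.
have [x [sx rx isoM]] := triv M dM fM dimM exM.
have [y [sy ry isoN]] := triv N dN fN dimN exN.
have [|||g [h [sg sh ug uh [z sz [eg eh]]]]] := rigid_conjugate _ _ _ sx sy rx ry.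
- by move=> p; rewrite /qrel reach_refl.
- by move=> p q r; apply: qrel_nrel_trans.
- by move=> p q r; apply: nrel_qrel_trans.
apply: isomorphic_trans isoM _; apply: isomorphic_trans (isomorphic_sym isoN).
apply: (isomorphic_trans (N := std o n (@block d' n) z)).
  by apply: isomorphic_sym; apply: std_isomorphic (esym eg).
by apply: std_isomorphic (esym eh).
Qed.
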